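(* Let $n>3$ be a natural number and let $i\in\{0,1\}$ with $i\equiv n \pmod 2$. Then there exists a $3$-connected cubic planar graph $G$ that has at least $\binom{2n}{n-i}$ non-isomorphic strong embeddings on the torus and at least $\binom{2n}{n-1+i}$ non-isomorphic strong embeddings on the Klein bottle.
   Context: All graphs are undirected, connected, simple and finite. An embedding of $G$ on a surface $S$ (compact connected $2$-manifold without boundary) is an injective continuous map $\beta:G\to S$; all embeddings are cellular, i.e. every component of $S\setminus\beta(G)$ (a cell) is an open disc. A facial walk is the closed walk of $G$ bounding a cell. An embedding is strong if all facial walks are cycles (then called facial cycles). Two strong embeddings of $G$ are isomorphic if and only if their sets of facial cycles lie in the same orbit under the action of $\mathrm{Aut}(G)$; ''at least $N$ non-isomorphic strong embeddings'' means at least $N$ pairwise non-isomorphic ones. *)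

(* Defs.v *)
From HB Require Import structures.
From mathcomp Require Import all_boot all_order all_algebra perm.
From mathcomp Require Import all_classical all_reals all_analysis.
Import Order.TTheory GRing.Theory Num.Theory.
Import numFieldNormedType.Exports.
Set Implicit Arguments.
Unset Strict Implicit.
Unset Printing Implicit Defensive.
Local Open Scope classical_set_scope.
Local Open Scope ring_scope.
Local Open Scope quotient_scope.

Record sgraph := SGraph {
  vertex : finType;
  edge : rel vertex;
  edge_sym : symmetric edge;
  edge_irrefl : irreflexive edge }.

Definition cubic (G : sgraph) : Prop :=
  forall v : vertex G, #|[set u | edge v u]%SET| = 3%N.

Definition delete_edge (G : sgraph) (X : {set vertex G}) : rel (vertex G) :=
  fun u v => [&& u \notin X, v \notin X & edge u v].

(* For k > 0 this includes connectedness of G (take X empty). *)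
Definition vertex_connected (k : nat) (G : sgraph) : Prop :=
  (k < #|vertex G|)%N /\
  forall X : {set vertex G}, (#|X| < k)%N ->
    forall u v, u \notin X -> v \notin X -> connect (delete_edge X) u v.

Definition automorphism (G : sgraph) (s : {perm vertex G}) : Prop :=
  forall u v, edge (s u) (s v) = edge u v.

(* A closed walk of length k is indexed cyclically by 'I_k, [ordS] being the
   successor modulo k. *)
Definition closed_walk (G : sgraph) (k : nat) (w : 'I_k -> vertex G) : Prop :=
  (0 < k)%N /\ forall j, edge (w j) (w (ordS j)).

Definition is_cycle (G : sgraph) (k : nat) (w : 'I_k -> vertex G) : Prop :=
  [/\ closed_walk w, (2 < k)%N & injective w].

(* A cycle, as a subgraph, is identified with its set of edges. *)
Definition walk_edges (G : sgraph) (k : nat) (w : 'I_k -> vertex G) :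
    {set {set vertex G}} :=
  [set [set w j; w (ordS j)] | j : 'I_k]%SET.

Definition homeomorphic (X Y : topologicalType) (A : set X) (B : set Y) : Prop :=
  exists (f : X -> Y) (g : Y -> X),
    [/\ set_fun A B f, set_fun B A g,
        {in A, cancel f g}, {in B, cancel g f} &
        {within A, continuous f} /\ {within B, continuous g}].

Section Plane.
Variable R : realType.

(* The norm of the product R * R is the sup norm, hence the explicit
   Euclidean formulas. *)
Definition closed_disc : set (R * R) := [set p | p.1 ^+ 2 + p.2 ^+ 2 <= 1].
Definition open_disc : set (R * R) := [set p | p.1 ^+ 2 + p.2 ^+ 2 < 1].
Definition unit_circle : set (R * R) := [set p | p.1 ^+ 2 + p.2 ^+ 2 = 1].

Definition circle_param (l : R -> R * R) : Prop :=
  [/\ {within `[0, 1], continuous l}, l 0 = l 1,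
      {in `[0, 1[ &, injective l} & l @` `[0, 1] = unit_circle].

(* The torus is the quotient of the plane by the integer translations. *)
Definition torus_rel : rel (R * R) := fun p q =>
  `[< exists m n : int, q = (p.1 + m%:~R, p.2 + n%:~R) >].

(* The Klein bottle is the quotient of the plane by the group generated by
   (x, y) |-> (x + 1, - y) and (x, y) |-> (x, y + 1). *)
Definition klein_rel : rel (R * R) := fun p q =>
  `[< exists m n : int, q = (p.1 + m%:~R, (-1) ^ m * p.2 + n%:~R) >].

Lemma torus_rel_equiv : equiv_class_of torus_rel.
Proof.
split.
- by move=> p; apply/asboolP; exists 0, 0; rewrite !addr0; case: p.
- suff H p q : torus_rel p q -> torus_rel q p.
    by move=> p q; apply/idP/idP; apply: H.
  move=> /asboolP[m [n ->]]; apply/asboolP; exists (- m), (- n) => /=.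
  by rewrite !mulrNz !addrK; case: p.
- move=> q p r /asboolP[m [n ->]] /asboolP[m' [n' ->]].
  by apply/asboolP; exists (m + m'), (n + n'); rewrite /= !mulrzDr !addrA.
Qed.

Lemma klein_rel_equiv : equiv_class_of klein_rel.
Proof.
have sgz (m : int) : ((-1) ^ m)%:~R = (-1) ^ m :> R.
  by rewrite rmorphXz ?unitrN1 //= rmorphN1.
have sq (m : int) : (-1) ^ m * (-1) ^ m = 1 :> R.
  by rewrite -expfzMl mulrNN mulr1 exp1rz.
have N1neq0 : -1 != 0 :> R by rewrite oppr_eq0 oner_eq0.
have invN1 (m : int) : (-1) ^ (- m) = (-1) ^ m :> R.
  by apply: (mulIf (expfz_neq0 m N1neq0)); rewrite sq -expfzDr // addNr.
split.
- move=> p; apply/asboolP; exists 0, 0.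
  by rewrite !addr0 expr0z mul1r; case: p.
- suff H p q : klein_rel p q -> klein_rel q p.
    by move=> p q; apply/idP/idP; apply: H.
  move=> /asboolP[m [n ->]]; apply/asboolP.
  exists (- m), (- (-1) ^ m * n) => /=.
  rewrite mulrNz addrK invN1 intrM rmorphN /= sgz.
  by rewrite mulNr mulrDr addrK mulrA sq mul1r; case: p.
- move=> q p r /asboolP[m [n ->]] /asboolP[m' [n' ->]].
  apply/asboolP; exists (m + m'), ((-1) ^ m' * n + n') => /=.
  rewrite !mulrzDr intrM sgz addrA mulrDr mulrA addrA.
  by rewrite (addrC m m') expfzDr.
Qed.

Definition torus_equiv : equiv_rel (R * R) :=
  EquivRelPack torus_rel_equiv.
Definition klein_equiv : equiv_rel (R * R) :=
  EquivRelPack klein_rel_equiv.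

Definition torus : topologicalType :=
  quotient_topology {eq_quot torus_equiv}.
Definition klein_bottle : topologicalType :=
  quotient_topology {eq_quot klein_equiv}.

Section Embedding.
Variable G : sgraph.
Local Notation V := (vertex G).

Definition edge_point (u v : V) (t : R) : {ptws V -> R} :=
  fun x => (1 - t) * (x == u)%:R + t * (x == v)%:R.

(* Geometric realization of G in R^V: vertices are the standard basis vectors,
   edges the straight segments joining them. *)
Definition realization : set {ptws V -> R} :=
  [set x | exists u v t,
     [/\ u = v \/ edge u v, 0 <= t <= 1 & x = edge_point u v t]].

Definition planar : Prop :=
  exists b : {ptws V -> R} -> R * R,
    {within realization, continuous b} /\ {in realization &, injective b}.

Variable S : topologicalType.
(* Only the values of b on [realization] matter. *)
Implicit Types (b : {ptws V -> R} -> S).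

Definition is_embedding b : Prop :=
  {within realization, continuous b} /\ {in realization &, injective b}.

Definition is_cell b (C : set S) : Prop :=
  exists2 x, (~` (b @` realization)) x
    & C = connected_component (~` (b @` realization)) x.

Definition is_cellular b : Prop :=
  is_embedding b /\ forall C, is_cell b C -> homeomorphic open_disc C.

(* w is a facial walk of the cell C: C is the interior of a closed disc mapped
   continuously to S, injectively on its interior, whose boundary circle, run
   through once, traverses the successive edges of w. *)
Definition facial_walk b (C : set S) (k : nat) (w : 'I_k -> V) : Prop :=
  closed_walk w /\
  exists (phi : R * R -> S) (l : R -> R * R),
    [/\ {within closed_disc, continuous phi},
        {in open_disc &, injective phi},
        phi @` open_disc = C,
        circle_param l &
        forall (j : 'I_k) (t : R), 0 <= t <= 1 ->
          phi (l ((j%:R + t) / k%:R)) = b (edge_point (w j) (w (ordS j)) t)].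

(* The facial walk of a cell is unique up to the choice of its starting point
   and direction, so a cell having some facial walk which is a cycle is the
   same as its facial walks all being cycles. *)
Definition is_strong b : Prop :=
  is_cellular b /\
  forall C, is_cell b C ->
    exists (k : nat) (w : 'I_k -> V), facial_walk b C w /\ is_cycle w.

Definition facial_cycles b : set {set {set V}} :=
  [set E | exists (C : set S) (k : nat) (w : 'I_k -> V),
     [/\ is_cell b C, facial_walk b C w, is_cycle w & E = walk_edges w]].

Definition isomorphic_embeddings b1 b2 : Prop :=
  exists s : {perm V}, automorphism s /\
    facial_cycles b2 =
      [set [set [set s x | x in e] | e : {set V} in E]%SET | E in facial_cycles b1].

Definition at_least_strong_embeddings (N : nat) : Prop :=
  exists F : 'I_N -> {ptws V -> R} -> S,
    (forall a, is_strong (F a)) /\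
    (forall a c, a != c -> ~ isomorphic_embeddings (F a) (F c)).

End Embedding.
End Plane.

Arguments planar R G : clear implicits.
Arguments at_least_strong_embeddings R G S N : clear implicits.

(* Main.v *)
Require Import Defs.
From mathcomp Require Import all_boot all_order all_algebra perm.
From mathcomp Require Import all_classical all_reals all_analysis.
From mathcomp Require Import zify ring lra.
Import Order.TTheory GRing.Theory Num.Theory.
Import numFieldNormedType.Exports.
Set Implicit Arguments.
Unset Strict Implicit.
Unset Printing Implicit Defensive.
Local Open Scope classical_set_scope.
Local Open Scope ring_scope.

(** The graph is the prism over a cycle of [M] columns, for a large [M] that
depends on [n]: two rails, joined by one rung in each column. It has embeddings
on the torus and the Klein bottle that are all given by one formula.

Give every integer column [z] a sign [sg z], with [sg (z + M) = e * sg z], where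
[e = 1] for the torus and [e = -1] for the Klein bottle, and let [a] be the
piecewise linear function interpolating [sg]. In the universal cover of the
surface, with abscissas stretched by [M], the lower rail is the curve
[y = a x / 8] and the upper rail is [y = 1 / 2 - a x / 8], modulo 1. These two
curves never meet, and they cut the plane, modulo vertical translations, into
two bands, exchanged by [y |-> - y] and [a |-> - a]. The rung of column [z] is a
vertical segment crossing the band of sign [sg z]. Hence the faces correspond to
the pairs [c < d] of consecutive columns of equal sign: such a face is the part
over [(c, d)] of the band of sign [sg c], and its boundary runs through the lower
rail from [c] to [d], the rung of [d], the upper rail from [d] to [c] and the
rung of [c]. It is a cycle of length [2 * (d - c) + 2] if [d - c < M]. Vertical
rescaling, followed by a radial map, makes such a face an explicit image of the
disc, so that the embedding is cellular and strong ([signed_drawing_strong]).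

Non-isomorphism only uses the lengths of the facial cycles. By compactness the
edges of a facial walk of a cell are those in the closure of the cell
([facial_walk_edges]), so these lengths are determined by the embedding, and
they are preserved by isomorphisms. The sign pattern of index [k] has a run of
[k + 3] equal signs, hence a facial cycle with [d - c = k + 4], a value that no
pattern of another index below [N] produces when [M > 2 * N + 10]. So every
number of embeddings is reached on both surfaces by one large prism.

The prism is planar since, without the two edges closing the rails, it is a
ladder, and these two edges can be drawn on both sides of it. *)

(** * Continuity and the radial map from the disc to the square *)

Section RealContinuity.
Variables (R : realType) (T : topologicalType).
Implicit Types f g : T -> R.

Lemma comp_cont (U W : topologicalType) (f : T -> U) (g : U -> W) :
  continuous f -> continuous g -> continuous (fun x => g (f x)).
Proof. by move=> cf cg x; apply: continuous_comp; [exact: cf | exact: cg]. Qed.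

Lemma cvg_pair_at (U W : topologicalType) (x : T) (f : T -> U) (g : T -> W)
  (a : U) (b : W) :
  f y @[y --> x] --> a -> g y @[y --> x] --> b ->
  (f y, g y) @[y --> x] --> (a, b).
Proof. by move=> cf cg; apply: cvg_pair. Qed.

Lemma pair_cont (U W : topologicalType) (f : T -> U) (g : T -> W) :
  continuous f -> continuous g -> continuous (fun x => (f x, g x)).
Proof. by move=> cf cg x; apply: cvg_pair; [exact: cf | exact: cg]. Qed.

Lemma add_cont f g :
  continuous f -> continuous g -> continuous (fun x => f x + g x).
Proof. by move=> cf cg x; apply: cvgD; [exact: cf | exact: cg]. Qed.

Lemma opp_cont f : continuous f -> continuous (fun x => - f x).
Proof. by move=> cf x; apply: cvgN; exact: cf. Qed.

Lemma mul_cont f g :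
  continuous f -> continuous g -> continuous (fun x => f x * g x).
Proof. by move=> cf cg x; apply: cvgM; [exact: cf | exact: cg]. Qed.

Lemma norm_cont f : continuous f -> continuous (fun x => `|f x|).
Proof. by move=> cf x; apply: cvg_norm; exact: cf. Qed.

Lemma max_cont f g :
  continuous f -> continuous g -> continuous (fun x => Num.max (f x) (g x)).
Proof. by move=> cf cg x; apply: continuous_max; [exact: cf | exact: cg]. Qed.

Lemma min_cont f g :
  continuous f -> continuous g -> continuous (fun x => Num.min (f x) (g x)).
Proof. by move=> cf cg x; apply: continuous_min; [exact: cf | exact: cg]. Qed.

Lemma cst_cont (c : R) : continuous (fun _ : T => c).
Proof. by move=> x; exact: cvg_cst. Qed.

Lemma inv_cont f : (forall x, f x != 0) -> continuous f ->
  continuous (fun x => (f x)^-1).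
Proof. by move=> f0 cf x; apply: cvgV; [exact: f0 | exact: cf]. Qed.

End RealContinuity.

Section PlaneMaps.
Variable R : realType.

Lemma fst_cont : continuous (fst : R * R -> R).
Proof. by move=> p; apply: cvg_fst. Qed.

Lemma snd_cont : continuous (snd : R * R -> R).
Proof. by move=> p; apply: cvg_snd. Qed.

Definition norm2 (p : R * R) : R := Num.sqrt (p.1 ^+ 2 + p.2 ^+ 2).
Definition norm_sup (p : R * R) : R := Num.max `|p.1| `|p.2|.
Definition rescale (t : R) (p : R * R) : R * R := (t * p.1, t * p.2).
(** At the origin both ratios are [0 / 0 = 0], so that these maps are inverse to
each other on the whole plane. *)
Definition square_of_disc (p : R * R) := rescale (norm2 p / norm_sup p) p.
Definition disc_of_square (p : R * R) := rescale (norm_sup p / norm2 p) p.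

Lemma norm2_cont : continuous norm2.
Proof.
apply: (@comp_cont _ R R (fun p : R * R => p.1 ^+ 2 + p.2 ^+ 2) Num.sqrt).
  by apply: add_cont; apply: mul_cont; (exact: fst_cont || exact: snd_cont).
exact: sqrt_continuous.
Qed.

Lemma norm_sup_cont : continuous norm_sup.
Proof.
by apply: max_cont; apply: norm_cont; (exact: fst_cont || exact: snd_cont).
Qed.

Lemma norm2_ge0 p : 0 <= norm2 p. Proof. exact: sqrtr_ge0. Qed.

Lemma norm_sup_ge0 p : 0 <= norm_sup p.
Proof. by rewrite le_max normr_ge0. Qed.

Lemma norm_sup_eq0 p : (norm_sup p == 0) = (p == 0).
Proof.
apply/eqP/eqP => [h|->]; last by rewrite /norm_sup /= normr0 maxxx.
have h1 : `|p.1| <= 0 by rewrite -h le_max lexx.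
have h2 : `|p.2| <= 0 by rewrite -h le_max lexx orbT.
move: h1 h2; rewrite !normr_le0 => /eqP h1 /eqP h2.
by case: p h1 h2 {h} => a b /= -> ->.
Qed.

Lemma norm_sup_le2 p : norm_sup p <= norm2 p.
Proof.
have h1 : 0 <= p.1 ^+ 2 by exact: sqr_ge0.
have h2 : 0 <= p.2 ^+ 2 by exact: sqr_ge0.
by rewrite ge_max -!sqrtr_sqr !ler_wsqrtr //; lra.
Qed.

Lemma norm2_eq0 p : (norm2 p == 0) = (p == 0).
Proof.
apply/idP/eqP => [/eqP h|->].
  apply/eqP; rewrite -norm_sup_eq0 eq_le norm_sup_ge0 andbT -h.
  exact: norm_sup_le2.
by rewrite /norm2 /= !expr0n addr0 sqrtr0.
Qed.

Lemma norm2_rescale t p : 0 <= t -> norm2 (rescale t p) = t * norm2 p.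
Proof.
move=> t0; rewrite /norm2 /rescale /= !exprMn -mulrDr sqrtrM ?sqr_ge0 //.
by rewrite sqrtr_sqr ger0_norm.
Qed.

Lemma norm_sup_rescale t p : 0 <= t -> norm_sup (rescale t p) = t * norm_sup p.
Proof.
move=> t0; rewrite /norm_sup /rescale /= !normrM (ger0_norm t0).
by rewrite maxr_pMr.
Qed.

Lemma rescale_rescale s t p : rescale s (rescale t p) = rescale (s * t) p.
Proof. by rewrite /rescale /= !mulrA. Qed.

Lemma rescale0 t : rescale t 0 = 0 :> R * R.
Proof. by rewrite /rescale /= mulr0. Qed.

Lemma norm_sup_square_of_disc p : norm_sup (square_of_disc p) = norm2 p.
Proof.
rewrite norm_sup_rescale ?divr_ge0 ?norm2_ge0 ?norm_sup_ge0 //.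
have [->|p0] := eqVneq p 0.
  by rewrite (eqP (_ : norm2 0 == 0)) ?norm2_eq0 // !mul0r.
by rewrite divfK // norm_sup_eq0.
Qed.

Lemma norm2_disc_of_square p : norm2 (disc_of_square p) = norm_sup p.
Proof.
rewrite norm2_rescale ?divr_ge0 ?norm2_ge0 ?norm_sup_ge0 //.
have [->|p0] := eqVneq p 0.
  by rewrite (eqP (_ : norm_sup 0 == 0)) ?norm_sup_eq0 // !mul0r.
by rewrite divfK // norm2_eq0.
Qed.

Lemma square_of_discK : cancel square_of_disc disc_of_square.
Proof.
move=> p; have [->|p0] := eqVneq p 0.
  by rewrite /square_of_disc /disc_of_square !rescale0.
rewrite {1}/disc_of_square norm_sup_square_of_disc /square_of_disc.
rewrite norm2_rescale ?divr_ge0 ?norm2_ge0 ?norm_sup_ge0 // rescale_rescale.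
have n2 : norm2 p != 0 by rewrite norm2_eq0.
have ns : norm_sup p != 0 by rewrite norm_sup_eq0.
rewrite (_ : _ * _ = 1) /rescale; last by field; rewrite ?n2 ?ns.
by rewrite !mul1r; case: (p).
Qed.

Lemma disc_of_squareK : cancel disc_of_square square_of_disc.
Proof.
move=> p; have [->|p0] := eqVneq p 0.
  by rewrite /square_of_disc /disc_of_square !rescale0.
rewrite {1}/square_of_disc norm2_disc_of_square /disc_of_square.
rewrite norm_sup_rescale ?divr_ge0 ?norm2_ge0 ?norm_sup_ge0 // rescale_rescale.
have n2 : norm2 p != 0 by rewrite norm2_eq0.
have ns : norm_sup p != 0 by rewrite norm_sup_eq0.
rewrite (_ : _ * _ = 1) /rescale; last by field; rewrite ?n2 ?ns.
by rewrite !mul1r; case: (p).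
Qed.

(** Away from the origin this is composition of continuous maps; at the origin
the map is squeezed by a norm. *)
Lemma radial_cont (N N' : R * R -> R) :
  continuous N -> continuous N' -> (forall p, (N' p == 0) = (p == 0)) ->
  (forall p, norm_sup (rescale (N p / N' p) p) <= N p) -> N 0 = 0 ->
  continuous (fun p => rescale (N p / N' p) p).
Proof.
move=> cN cN' N'0 le N0 p; have [->|p0] := eqVneq p 0.
  have cN0 : N q @[q --> (0 : R * R)] --> (0 : R).
    by have := cN 0; rewrite /continuous_at N0.
  have cN1 : - N q @[q --> (0 : R * R)] --> (0 : R).
    by rewrite -[X in _ --> X]oppr0; apply: cvgN.
  have h i : (forall q, `|i q| <= norm_sup q) ->
     i (rescale (N q / N' q) q) @[q --> (0 : R * R)] --> (0 : R).
    move=> ile; apply: (@squeeze_cvgr _ _ _ _ (fun q => - N q) N).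
    - by apply: nearW => q; rewrite -ler_norml; apply: le_trans (le q);
      exact: ile.
    - exact: cN1.
    - exact: cN0.
  rewrite /continuous_at rescale0.
  apply: (@cvg_pair_at _ R R _ (fun q => (rescale (N q / N' q) q).1)
            (fun q => (rescale (N q / N' q) q).2)).
    by apply: (h fst) => q; rewrite le_max lexx.
  by apply: (h snd) => q; rewrite le_max lexx orbT.
have c : (N q / N' q) @[q --> p] --> N p / N' p.
  by apply: cvgM; [exact: cN|apply: cvgV; rewrite ?N'0 //; exact: cN'].
apply: (@cvg_pair_at _ R R _ (fun q => N q / N' q * q.1)
          (fun q => N q / N' q * q.2)); apply: cvgM => //.
  exact: fst_cont.
exact: snd_cont.
Qed.

Lemma square_of_disc_cont : continuous square_of_disc.
Proof.
apply: radial_cont; [exact: norm2_cont|exact: norm_sup_cont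
  |exact: norm_sup_eq0| |by apply/eqP; rewrite norm2_eq0].
by move=> p; rewrite -/(square_of_disc p) norm_sup_square_of_disc.
Qed.

Lemma disc_of_square_cont : continuous disc_of_square.
Proof.
apply: radial_cont; [exact: norm_sup_cont|exact: norm2_cont
  |exact: norm2_eq0| |by apply/eqP; rewrite norm_sup_eq0].
move=> p; rewrite -/(disc_of_square p) -[leRHS]norm2_disc_of_square.
exact: norm_sup_le2.
Qed.

Lemma norm2_lt1 p : (norm2 p < 1) = (p.1 ^+ 2 + p.2 ^+ 2 < 1).
Proof. by rewrite -{1}(sqrtr1 R) ltr_sqrt. Qed.

Lemma norm2_eq1 p : (norm2 p == 1) = (p.1 ^+ 2 + p.2 ^+ 2 == 1).
Proof.
rewrite -{1}(sqrtr1 R) eqr_sqrt //.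
by rewrite addr_ge0 ?sqr_ge0.
Qed.

Lemma norm2_le1 p : (norm2 p <= 1) = (p.1 ^+ 2 + p.2 ^+ 2 <= 1).
Proof. by rewrite !le_eqVlt norm2_eq1 norm2_lt1. Qed.

End PlaneMaps.

(** * Continuity of maps on the realization of a graph *)

Lemma within_finite_union (T U : topologicalType) (I : eqType) (s : seq I)
    (A : I -> set T) (f : T -> U) :
  (forall i, i \in s -> closed (A i)) ->
  (forall i, i \in s -> {within A i, continuous f}) ->
  {within [set x | exists2 i, i \in s & A i x], continuous f}.
Proof.
move=> cA cf.
suff [] : closed [set x | exists2 i, i \in s & A i x] /\
  {within [set x | exists2 i, i \in s & A i x], continuous f} by [].
elim: s cA cf => [|i s IH] cA cf.
  rewrite (_ : [set x | _] = set0).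
    by split; [exact: closed0 | exact: continuous_subspace0].
  by rewrite predeqE => x; split => [[i]|//]; rewrite in_nil.
have [] := IH; [| |move=> cs fs].
- by move=> j js; apply: cA; rewrite in_cons js orbT.
- by move=> j js; apply: cf; rewrite in_cons js orbT.
have ii : i \in i :: s by rewrite mem_head.
rewrite (_ : [set x | _] = A i `|` [set x | exists2 j, j \in s & A j x]).
  split; first by apply: closedU => //; exact: cA.
  by apply: withinU_continuous => //; [exact: cA | exact: cf].
rewrite predeqE => x; split => [[j]|[Ax|[j js Ax]]].
- by rewrite in_cons => /orP[/eqP->|js] Ax; [left|right; exists j].
- by exists i.
- by exists j => //; rewrite in_cons js orbT.
Qed.

Section Realization.
Variables (R : realType) (G : sgraph).
Local Notation V := (vertex G).
Implicit Types (u v w : V) (t : R).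

Lemma edge_pointE u v t w :
  edge_point u v t w = (1 - t) * (w == u)%:R + t * (w == v)%:R.
Proof. by []. Qed.

Lemma edge_point_sym u v t : edge_point u v t = edge_point v u (1 - t).
Proof. by apply: funext => w; rewrite !edge_pointE; ring. Qed.

Lemma edge_neq u v : edge u v -> u != v.
Proof. by apply: contraTneq => ->; rewrite edge_irrefl. Qed.

Lemma edge_point_tgt u v t : u != v -> edge_point u v t v = t.
Proof.
by move=> uv; rewrite edge_pointE eqxx eq_sym (negbTE uv) mulr0 add0r mulr1.
Qed.

Lemma coord_cont (w : V) : continuous (fun x : {ptws V -> R} => x w).
Proof. exact: (@proj_continuous _ (fun=> R) w). Qed.

Definition edge_segment u v : set {ptws V -> R} :=
  [set x | exists2 t, 0 <= t <= 1 & x = edge_point u v t].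

Lemma edge_segmentE u v : u != v ->
  edge_segment u v =
  [set x : {ptws V -> R} | 0 <= x v /\ 0 <= 1 - x v /\
    forall w, x w - edge_point u v (x v) w = 0].
Proof.
move=> uv; rewrite predeqE => x; split => [[t t01 ->]|[x0 [x1 xE]]].
  have tE := edge_point_tgt t uv; split; first by rewrite tE; lra.
  by split => [|w]; rewrite tE; [lra | rewrite subrr].
exists (x v); first by lra.
by apply: funext => w; apply/eqP; rewrite -subr_eq0 xE.
Qed.

Lemma edge_segment_closed u v : u != v -> closed (edge_segment u v).
Proof.
move=> uv; rewrite edge_segmentE //.
have cle (f : {ptws V -> R} -> R) : continuous f -> closed [set x | 0 <= f x].
  by move=> cf; apply: (@closed_comp _ _ f [set y | 0 <= y]) => //;
    exact: closed_ge.
have ceq (f : {ptws V -> R} -> R) : continuous f -> closed [set x | f x = 0].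
  move=> cf; rewrite (_ : [set x | _] = [set x | 0 <= f x] `&` [set x | 0 <= -
    f x]).
    by apply: closedI; apply: cle => //; exact: opp_cont.
  by rewrite predeqE => x /=; split => [->|[]]; lra.
rewrite (_ : [set x | _] = [set x : {ptws V -> R} | 0 <= x v] `&`
  ([set x : {ptws V -> R} | 0 <= 1 - x v] `&`
   \bigcap_w [set x : {ptws V -> R} | x w - edge_point u v (x v) w = 0])).
  have cv := @coord_cont v.
  have c1 : continuous (fun x : {ptws V -> R} => 1 - x v).
    by apply: add_cont; [exact: cst_cont | exact: opp_cont].
  apply: closedI; first exact: cle.
  apply: closedI; first exact: cle.
  apply: closed_bigI => w _; apply: ceq.
  apply: add_cont; first exact: coord_cont.
  by apply: opp_cont; apply: add_cont; apply: mul_cont => //; exact: cst_cont.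
rewrite predeqE => x /=; split=> [[? [? h]]|[? [? h]]]; split => //;
  split => //.
  by move=> w _; apply: h.
by move=> w; apply: (h w).
Qed.

(** The realization is a finite union of closed segments, one for each edge, on
which the parameter is a coordinate. *)
Lemma realization_continuous (S : topologicalType) (b : {ptws V -> R} -> S) :
  (forall v, exists u, edge v u) ->
  (forall u v, edge u v -> exists2 g : R -> S, continuous g &
     forall t, 0 <= t <= 1 -> b (edge_point u v t) = g t) ->
  {within @realization R G, continuous b}.
Proof.
move=> nbr along.
pose s := [seq p : V * V <- enum [set: V * V]%SET | edge p.1 p.2].
have sE p : (p \in s) = edge p.1 p.2.
  by rewrite mem_filter mem_enum inE andbT.
rewrite (_ : realization (G:=G) =
    [set x | exists2 p, p \in s & edge_segment p.1 p.2 x]).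
  apply: within_finite_union => p; rewrite sE => e.
    exact/edge_segment_closed/edge_neq.
  have [g cg gE] := along _ _ e.
  apply: (@subspace_eq_continuous _ (edge_segment p.1 p.2) _
    (fun x : {ptws V -> R} => g (x p.2))).
    move=> x; rewrite inE => -[t t01 ->].
    rewrite /from_subspace gE //.
    by rewrite edge_point_tgt ?edge_neq.
  apply: continuous_subspaceT => x.
  exact: (comp_cont (@coord_cont p.2) cg).
rewrite predeqE => x; split => [[u [v [t [uv t01 ->]]]]|[p]].
  case: uv => [<-|e]; last by exists (u, v); rewrite ?sE //; exists t.
  have [w e] := nbr u; exists (u, w); rewrite ?sE //=.
  exists 0; first by rewrite lexx ler01.
  by apply: funext => z; rewrite !edge_pointE; ring.
by rewrite sE => e [t t01 ->]; exists p.1, p.2, t; split => //; right.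
Qed.

End Realization.

(** * Cells: components, discs and their closures *)

Section Topology.
Variables X Y : topologicalType.

(** A piece is open, and closed relatively to [D] because the other pieces are
open; a connected set meeting it is thus contained in it. *)
Lemma component_of_partition (I : Type) (D : set X) (C : I -> set X) :
  D = \bigcup_i C i -> (forall i, open (C i)) -> (forall i, connected (C i)) ->
  (forall i j, C i `&` C j !=set0 -> C i = C j) ->
  forall i x, C i x -> connected_component D x = C i.
Proof.
move=> DE oC cC dC i x Cx; rewrite eqEsubset; split; last first.
  by apply: connected_component_max => //; rewrite DE => y Cy; exists i.
move=> y Ky; set K := connected_component D x in Ky.
suff KE : K `&` C i = K by move: Ky; rewrite -KE => -[].
apply: (@component_connected _ D x); rewrite -/K.
- exists x; split => //; apply: connected_component_refl.
  by rewrite DE; exists i.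
- by exists (C i).
- pose O := \bigcup_(j in [set j | C j <> C i]) C j.
  exists (~` O); first by apply: open_closedC; apply: bigcup_open => j _.
  rewrite predeqE => z; split => [[Kz Cz]|[Kz nOz]]; split => //.
    move=> [j /= ne Cjz]; apply: ne; apply: dC; by exists z.
  have := @connected_component_sub _ D x _ Kz; rewrite DE => -[j _ Cjz].
  by have [<-|ne] := pselect (C j = C i) => //; case: nOz; exists j.
Qed.

Lemma homeomorphic_image (O : set X) (f : X -> Y) :
  {within O, continuous f} -> {in O &, injective f} ->
  (forall U, open U -> U `<=` O -> open (f @` U)) -> open O ->
  (exists x, O x) -> homeomorphic O (f @` O).
Proof.
move=> cf injf of_ oO [x0 Ox0].
pose g y := xget x0 [set x | O x /\ f x = y].
have gP y : (f @` O) y -> O (g y) /\ f (g y) = y.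
  move=> [x Ox xy]; have := xgetPex x0 (P := [set x | O x /\ f x = y]).
  by apply; exists x.
exists f, g; split.
- by move=> x Ox; exists x.
- by move=> y /gP[].
- move=> x; rewrite inE => Ox; have [|h1 h2] := gP (f x); first by exists x.
  by apply: injf; rewrite ?inE.
- by move=> y; rewrite inE => /gP[].
split => //; apply/subspace_continuousP => y fOy A /=.
have [Og gy] := gP _ fOy; rewrite nbhsE => -[B [oB Bg] BA].
have oB' : open (f @` (B `&` O)) by apply: of_; [exact: openI | move=> z []].
change (nbhs y [set z | (f @` O) z -> A (g z)]).
apply: (@filterS _ _ _ (f @` (B `&` O))).
  move=> _ [x [Bx Ox] <-] fOx; have [h1 h2] := gP _ fOx.
  rewrite (_ : g (f x) = x); first exact: BA.
  by apply: injf; rewrite ?inE.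
by apply: open_nbhs_nbhs; split => //; exists (g y).
Qed.

Lemma closure_image_within (A B : set X) (f : X -> Y) :
  {within A, continuous f} -> B `<=` A -> A `<=` closure B ->
  f @` A `<=` closure (f @` B).
Proof.
move=> cf BA AB _ [x Ax <-] N Nx.
have /subspace_continuousP/(_ x Ax N Nx) h := cf.
have /(AB x Ax)[z [Bz /(_ (BA _ Bz)) Nz]] : nbhs x [set z | A z -> N (f z)] :=
  h.
by exists (f z); split => //; exists z.
Qed.

End Topology.

Section Disc.
Variable R : realType.
Local Notation open_disc := (@open_disc R).
Local Notation closed_disc := (@closed_disc R).

Lemma open_discE : open_disc = [set p | norm2 p < 1].
Proof. by rewrite predeqE => p; rewrite /= norm2_lt1. Qed.

Lemma closed_discE : closed_disc = [set p | norm2 p <= 1].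
Proof. by rewrite predeqE => p; rewrite /= norm2_le1. Qed.

Lemma unit_circleE : @unit_circle R = [set p | norm2 p = 1].
Proof.
rewrite predeqE => p; split=> /= /eqP; first by rewrite -norm2_eq1 => /eqP.
by rewrite norm2_eq1 => /eqP.
Qed.

Lemma open_disc_open : open open_disc.
Proof.
rewrite open_discE; apply: (@open_comp _ _ (@norm2 R) [set y | y < 1]).
  by move=> p _; exact: norm2_cont.
exact: open_lt.
Qed.

Lemma open_disc_sub : open_disc `<=` closed_disc.
Proof. by rewrite open_discE closed_discE => p /= /ltW. Qed.

Lemma closed_disc_compact : compact closed_disc.
Proof.
apply: (@subclosed_compact _ _ (`[-1, 1] `*` `[-1, 1] : set (R * R))).
- rewrite closed_discE; apply: (@closed_comp _ _ (@norm2 R) [set y | y <= 1]).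
    by move=> p _; exact: norm2_cont.
  exact: closed_le.
- by apply: compact_setX; exact: segment_compact.
- rewrite closed_discE => p /= p1.
  have : norm_sup p <= 1 by apply: le_trans p1; exact: norm_sup_le2.
  by rewrite /norm_sup ge_max !ler_norml => /andP[h1 h2]; rewrite !in_itv.
Qed.

Lemma rescale_cont (p : R * R) : continuous (fun t : R => rescale t p).
Proof.
by apply: pair_cont; apply: mul_cont; (exact: cst_cont || move=> t;
  exact: cvg_id).
Qed.

Lemma closed_disc_closure : closed_disc `<=` closure open_disc.
Proof.
rewrite closed_discE open_discE => p /= p1 N Np.
have : nbhs (1 : R) [set t | N (rescale t p)].
  apply: (@rescale_cont p 1); rewrite /rescale !mul1r; by case: (p) Np.
move=> /nbhs_ballP[e /= e0 eN].
pose t := 1 - Num.min 1 (e / 2).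
have m0 : 0 < Num.min 1 (e / 2) by rewrite lt_min ltr01 divr_gt0.
have me : Num.min 1 (e / 2) <= e / 2 by rewrite ge_min lexx orbT.
have m1 : Num.min 1 (e / 2) <= 1 by rewrite ge_min lexx.
exists (rescale t p); split.
  rewrite /= norm2_rescale ?subr_ge0 //.
  have : t * norm2 p <= t * 1 by rewrite ler_wpM2l // subr_ge0.
  by rewrite mulr1 => h; apply: le_lt_trans h _; rewrite /t; lra.
by apply: eN; rewrite /ball /= /t opprB addrC subrK gtr0_norm //; lra.
Qed.

Lemma open_disc_connected : connected open_disc.
Proof.
rewrite (_ : open_disc = \bigcup_(p in open_disc)
    [set rescale t p | t in `[0, 1]]).
  apply: bigcup_connected.
    exists 0 => p _; exists 0; first by rewrite /= in_itv /= lexx ler01.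
    by rewrite /rescale !mul0r.
  move=> p _; apply: connected_continuous_connected.
    exact: segment_connected.
  apply: continuous_subspaceT; exact: rescale_cont.
rewrite open_discE predeqE => p; split => [p1|[q /= q1 [t]]].
  exists p => //; exists 1; first by rewrite /= in_itv /= lexx ler01.
  by rewrite /rescale !mul1r; case: (p).
rewrite /= in_itv /= => /andP[t0 t1] <-; rewrite norm2_rescale //.
by apply: le_lt_trans q1; rewrite ler_piMl ?norm2_ge0.
Qed.

End Disc.

(** * Facial walks *)

Section FacialWalks.
Variables (R : realType) (G : sgraph).
Local Notation V := (vertex G).

Lemma subdivide (k : nat) (x : R) : (0 < k)%N -> 0 <= x <= 1 ->
  exists (j : 'I_k) (t : R), 0 <= t <= 1 /\ x = (j%:R + t) / k%:R.
Proof.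
case: k => // k _ /andP[x0]; rewrite le_eqVlt => /orP[/eqP->|x1].
  exists ord_max, 1; split; first by lra.
  by rewrite -natr1 divff //= natr1 pnatr_eq0.
have k0 : 0 < k.+1%:R :> R by rewrite ltr0n.
have xk0 : 0 <= x * k.+1%:R by rewrite mulr_ge0 // ltW.
have /andP[h1 h2] := truncn_itv xk0.
have jk : (Num.truncn (x * k.+1%:R) < k.+1)%N.
  rewrite -(ltr_nat R); apply: le_lt_trans h1 _.
  by rewrite -[ltRHS]mul1r ltr_pM2r.
exists (Ordinal jk), (x * k.+1%:R - (Num.truncn (x * k.+1%:R))%:R); split.
  by move: h2; rewrite -[(Num.truncn _).+1%:R]natr1; lra.
by rewrite /= addrC subrK mulfK // gt_eqF.
Qed.

(** The two coordinates of the midpoint of [uv] that do not vanish are those of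
[u] and [v]. *)
Lemma midpoint_edge (u v a b : V) (t : R) : u != v ->
  edge_point u v (2^-1) = edge_point a b t -> [set u; v]%SET = [set a; b]%SET.
Proof.
move=> uv E.
have mem w : (w == u) || (w == v) -> (w == a) || (w == b).
  move=> wuv; have := congr1 (fun f : {ptws V -> R} => f w) E.
  rewrite !edge_pointE; have [->|wa] := eqVneq w a; first by [].
  have [->|wb] := eqVneq w b; first by rewrite orbT.
  case/orP: wuv => /eqP->;
    rewrite eqxx ?(negbTE uv) ?[v == u]eq_sym ?(negbTE uv) /=; lra.
have := mem u; have := mem v; rewrite !eqxx orbT /=.
move=> /(_ isT)/orP[]/eqP vE /(_ isT)/orP[]/eqP uE; move: uv;
  rewrite uE vE ?eqxx //.
by rewrite finset.setUC.
Qed.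

(** By compactness the closure of the cell is the image of the closed disc, so the
image of the circle is the part of the drawing that lies in this closure. Hence
the edges of a facial walk depend on the cell only. *)
Lemma facial_walk_edges (S : topologicalType) (b : {ptws V -> R} -> S)
    (C : set S) (k : nat) (w : 'I_k -> V) :
  hausdorff_space S -> {in @realization R G &, injective b} ->
  C `&` (b @` @realization R G) = set0 -> facial_walk b C w ->
  walk_edges w = [set e : {set V} | `[< exists u v,
    [/\ edge u v, e = [set u;
      v]%SET & closure C (b (edge_point u v 2^-1))] >]]%SET.
Proof.
move=> hS injb disj [[k0 cw] [phi [l [cphi _ phiC [_ _ _ lU] phil]]]].
have closE : closure C = phi @` @closed_disc R.
  rewrite eqEsubset; split.
    rewrite closureE => x; apply; split; last first.
      by rewrite -phiC => _ [p Op <-]; exists p => //; exact: open_disc_sub.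
    apply: compact_closed => //; apply: continuous_compact => //.
    exact: closed_disc_compact.
  rewrite -phiC; apply: closure_image_within cphi _ _.
    exact: open_disc_sub.
  exact: closed_disc_closure.
have half : 0 <= (2^-1 : R) <= 1 by lra.
apply/setP => e; rewrite inE; apply/imsetP/asboolP => [[j _ ->]|].
  exists (w j), (w (ordS j)); split => //; rewrite -phil // closE.
  exists (l ((j%:R + 2^-1) / k%:R)) => //.
  have : (@unit_circle R) (l ((j%:R + 2^-1) / k%:R)).
    rewrite -lU; exists ((j%:R + 2^-1) / k%:R) => //.
    have kR : 0 < k%:R :> R by rewrite ltr0n.
    have jR : j.+1%:R <= k%:R :> R by rewrite ler_nat.
    rewrite /= in_itv /= divr_ge0 ?addr_ge0 ?invr_ge0 ?ler0n // ler_pdivrMr //.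
    by rewrite mul1r; move: jR; rewrite -natr1; lra.
  by rewrite unit_circleE closed_discE /= => ->.
move=> [u [v [uv -> ]]]; rewrite closE => -[p pD phip].
have bR : realization (edge_point u v (2^-1 : R)).
  by exists u, v, 2^-1; split => //; right.
have pU : (@unit_circle R) p.
  rewrite unit_circleE /=; apply: contrapT => pn1.
  have : set0 (b (edge_point u v 2^-1)).
    rewrite -disj; split; last by exists (edge_point u v 2^-1).
    rewrite -phip -phiC; exists p => //.
    move: pD; rewrite open_discE closed_discE /= le_eqVlt => /orP[/eqP//|//].
  by [].
move: pU; rewrite -lU => -[x /=]; rewrite in_itv /= => x01 lx.
have [j [t [t01 xE]]] := subdivide k0 x01.
exists j => //; apply: (@midpoint_edge _ _ _ _ t); first exact: edge_neq.
apply: injb; rewrite ?inE //.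
  by exists (w j), (w (ordS j)), t; split => //; right.
by rewrite -phil // -xE lx.
Qed.

(** Consecutive vertices determine the position on a cycle of length at least
three, so a facial cycle has as many edges as vertices. *)
Lemma card_walk_edges (k : nat) (w : 'I_k -> V) :
  is_cycle w -> #|walk_edges w| = k.
Proof.
move=> [[k0 cw] k2 injw]; rewrite /walk_edges card_in_imset ?card_ord //.
move=> i j _ _ /= E.
have : w i \in [set w j; w (ordS j)]%SET by rewrite -E !inE eqxx.
have : w (ordS i) \in [set w j; w (ordS j)]%SET by rewrite -E !inE eqxx orbT.
rewrite !inE !(inj_eq injw) => h1 /orP[/eqP//|/eqP ij].
move: h1; rewrite ij => /orP[/eqP h|/eqP h].
  have := congr1 (@nat_of_ord k) h; rewrite /= => h'.
  have jk := ltn_ord j; move: h' k2; have [jE|jne] := eqVneq j.+1 k.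
    by rewrite jE modnn => h' k2; move: h'; rewrite modn_small; lia.
  have jk' : (j.+1 < k)%N by lia.
  rewrite (modn_small jk'); have [jE'|jne'] := eqVneq j.+2 k.
    by rewrite jE' modnn; lia.
  by rewrite modn_small; lia.
move: h; move: (ordS j) => o /(congr1 (@nat_of_ord k)) /=.
have ok := ltn_ord o; have [oE|one] := eqVneq o.+1 k.
  by rewrite oE modnn; lia.
by rewrite modn_small; lia.
Qed.

Lemma isomorphic_cycle_length (S : topologicalType)
    (b1 b2 : {ptws V -> R} -> S) E :
  isomorphic_embeddings b1 b2 -> facial_cycles b1 E ->
  exists2 E', facial_cycles b2 E' & #|E'| = #|E|.
Proof.
move=> [s [_ ->]] bE; exists [set [set s x | x in e] | e : {set V} in E]%SET.
  by exists E.
rewrite card_imset // => e e' ee'; apply/setP => x.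
have : (s x \in [set s x | x in e]%SET) = (s x \in [set s x | x in e']%SET).
  by rewrite ee'.
by rewrite !mem_imset //; exact: perm_inj.
Qed.

End FacialWalks.

(** * The torus and the Klein bottle as quotients of the plane *)

Section Covers.
Variable R : realType.

Lemma sign_exprz (e : R) (m : int) : e = 1 \/ e = -1 -> e ^ m = 1 \/ e ^ m = -1.
Proof.
move=> [->|->]; first by left; rewrite exp1rz.
elim/int_rect: m => [|m [IH|IH]|m [IH|IH]]; first by left; rewrite expr0z.
- by right; rewrite intS exprzDr ?unitrN1 // IH expr1z mulr1.
- by left; rewrite intS exprzDr ?unitrN1 // IH expr1z mulrNN mulr1.
- right; rewrite intS opprD exprzDr ?unitrN1 // IH mulr1.
  by rewrite exprN1 invrN1.
- left; rewrite intS opprD exprzDr ?unitrN1 // IH.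
  by rewrite exprN1 invrN1 mulrNN mulr1.
Qed.

Definition deck (e : R) (m n : int) (p : R * R) : R * R :=
  (p.1 + m%:~R, e ^ m * p.2 + n%:~R).

(** [p] makes [S] the quotient of the plane by the group generated by
[(x, y) |-> (x, y + 1)] and [(x, y) |-> (x + M, e * y)]. The stretching by [M]
serves to place the columns of a drawing at integer abscissas. *)
Record plane_cover (S : topologicalType) (e M : R) (p : R * R -> S) : Prop :=
  PlaneCover {
    cover_cont : continuous p;
    cover_open : forall U, open U -> open (p @` U);
    cover_surj : forall s, exists x, p x = s;
    cover_eq : forall x y, p x = p y <->
      exists m n : int, y = (x.1 + m%:~R * M, e ^ m * x.2 + n%:~R);
    cover_hausdorff : hausdorff_space S }.

(** An integer so close to [x] can only be [x], since [x] has positive distance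
to the other integers. *)
Lemma integer_gap (x : R) :
  exists2 d : R, 0 < d & forall m : int, `|x - m%:~R| < d -> x = m%:~R.
Proof.
have /andP[f0 f1] := floor_itv x; set f := Num.floor x in f0 f1.
rewrite intrD in f1.
have h (m : int) : (m <= f) -> m%:~R <= f%:~R :> R by rewrite ler_int.
have h' (m : int) : (f + 1 <= m) -> f%:~R + 1 <= m%:~R :> R.
  by rewrite -(ler_int R) intrD.
have [xf|xf] := eqVneq x f%:~R.
  exists 1 => // m; rewrite {1}xf -intrB -intr_norm -[1]/(1%:~R) ltr_int.
  by move=> fm; rewrite xf; congr (_%:~R); lia.
have xf' : f%:~R < x by rewrite lt_neqAle eq_sym xf.
exists (Num.min (x - f%:~R) (f%:~R + 1 - x)); first by rewrite lt_min; lra.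
move=> m; rewrite lt_min ltr_norml => /andP[/andP[a b] c].
have [mf|fm] := leP m f; first by have := h _ mf; lra.
have := h' m.
move: c; rewrite ltr_norml => /andP[c d] hm.
suff : f%:~R + 1 <= m%:~R :> R by lra.
by apply: hm; lia.
Qed.

Section Quotient.
Variables (r : equiv_rel (R * R)) (e : R).
Hypothesis e1 : e = 1 \/ e = -1.
Hypothesis rE : forall p q, r p q <-> exists m n, q = deck e m n p.
Local Open Scope quotient_scope.
Local Notation S := (quotient_topology {eq_quot r}).
Local Notation proj := (\pi_S : R * R -> S).

Lemma proj_eq p q : proj p = proj q <-> exists m n, q = deck e m n p.
Proof.
by rewrite -rE; split=> h; apply/eqmodP.
Qed.

Lemma deck_cont m n : continuous (deck e m n).
Proof.
apply: pair_cont.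
  by apply: add_cont; [exact: fst_cont | exact: cst_cont].
apply: add_cont; last exact: cst_cont.
by apply: mul_cont; [exact: cst_cont | exact: snd_cont].
Qed.

Lemma proj_open U : open U -> open (proj @` U).
Proof.
move=> oU; rewrite /open /= /quotient_open.
rewrite (_ : _ @^-1` _ = \bigcup_(mn : int * int) (deck e mn.1 mn.2 @^-1` U)).
  apply: bigcup_open => -[m n] _; apply: open_comp => // p _.
  exact: deck_cont.
rewrite predeqE => p; split => [[q Uq /esym/proj_eq[m [n qE]]]|[[m n] _ Up]].
  by exists (m, n) => //=; rewrite -qE.
by exists (deck e m n p) => //; apply/esym/proj_eq; exists m, n.
Qed.

Lemma proj_surj s : exists p, proj p = s.
Proof. by exists (repr s); exact: reprK. Qed.

(** A deck transformation taking a point close to [p] to a point close to [q] has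
its two integer parameters close to given reals, hence equal to them by
[integer_gap]; it then takes [p] to [q]. *)
Lemma quotient_hausdorff : hausdorff_space S.
Proof.
rewrite open_hausdorff => s s'; have [p <-] := proj_surj s.
have [q <-] := proj_surj s' => ne.
have [d1 d10 h1] := integer_gap (q.1 - p.1).
have [d2 d20 h2] := integer_gap (q.2 - p.2).
have [d3 d30 h3] := integer_gap (q.2 + p.2).
pose d := Num.min d1 (Num.min d2 d3) / 2.
have d0 : 0 < d by rewrite divr_gt0 // !lt_min d10 d20.
have dd1 : 2 * d <= d1 by rewrite mulrC divfK // ge_min lexx.
have dd2 : 2 * d <= d2 by rewrite mulrC divfK // !ge_min lexx orbT.
have dd3 : 2 * d <= d3 by rewrite mulrC divfK // !ge_min lexx !orbT.
have ob x : open (ball x d : set (R * R)) by exact: ball_open.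
exists (proj @` ball p d, proj @` ball q d) => /=.
  by split; rewrite inE; [exists p | exists q] => //; exact: ballxx.
split; [exact: proj_open | exact: proj_open |].
apply/eqP; rewrite predeqE => x;
  split => // -[[p' [pp1 pp2] <-] [q' [qq1 qq2]]].
move=> /esym/proj_eq[m [n q'E]]; case/negP: ne; apply/eqP/proj_eq.
exists m, n; move: pp1 pp2 qq1 qq2;
  rewrite {}q'E /deck /ball /= => pp1 pp2 qq1 qq2.
have E1 : q.1 = p.1 + m%:~R.
  suff <- : q.1 - p.1 = m%:~R by lra.
  by apply: h1; move: pp1 qq1; rewrite !ltr_norml; lra.
suff E2 : q.2 = e ^ m * p.2 + n%:~R by rewrite -E1 -E2; case: (q).
case: (sign_exprz m e1) qq2 => -> qq2; last rewrite mulN1r in qq2 *.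
  suff : q.2 - p.2 = n%:~R by lra.
  by apply: h2; move: pp2 qq2; rewrite mul1r !ltr_norml; lra.
suff : q.2 + p.2 = n%:~R by lra.
by apply: h3; move: pp2 qq2; rewrite !ltr_norml; lra.
Qed.

Lemma quotient_cover (M : R) : 0 < M ->
  plane_cover e M (fun x : R * R => proj (x.1 / M, x.2)).
Proof.
move=> M0; have M1 : M != 0 by rewrite gt_eqF.
have sc (k : R) : continuous (fun x : R * R => (x.1 * k, x.2)).
  apply: pair_cont; last exact: snd_cont.
  by apply: mul_cont; [exact: fst_cont | exact: cst_cont].
split.
- by apply: (comp_cont (sc M^-1)); exact: pi_continuous.
- move=> U oU; rewrite (_ : _ @` U =
     proj @` ((fun x : R * R => (x.1 * M, x.2)) @^-1` U)).
    by apply: proj_open; apply: open_comp => // x _; exact: sc.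
  rewrite predeqE => s; split => [[x Ux <-]|[x Ux <-]].
    by exists (x.1 / M, x.2) => //=; rewrite divfK //; case: (x) Ux.
  by exists (x.1 * M, x.2) => //=; rewrite mulfK //; case: (x).
- move=> s; have [p <-] := proj_surj s; exists (p.1 * M, p.2) => /=.
  by rewrite mulfK //; case: (p).
- move=> x y; rewrite proj_eq /deck /=; split => -[m [n E]]; exists m, n.
    case: E => E1 <-; case: y E1 => y1 y2 /= E1; congr pair.
    by rewrite -[LHS](divfK M1) E1 mulrDl divfK.
  by rewrite E /= mulrDl mulfK.
- exact: quotient_hausdorff.
Qed.

End Quotient.

Lemma torus_cover (M : R) : 0 < M ->
  exists p : R * R -> torus R, plane_cover 1 M p.
Proof.
move=> M0; eexists; apply: (@quotient_cover (torus_equiv R) 1 _ _ M M0).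
  by left.
move=> p q; split => [/asboolP[m [n ->]]|[m [n ->]]]; last apply/asboolP.
  by exists m, n; rewrite /deck exp1rz mul1r.
by exists m, n; rewrite /deck exp1rz mul1r.
Qed.

Lemma klein_cover (M : R) : 0 < M ->
  exists p : R * R -> klein_bottle R, plane_cover (-1) M p.
Proof.
move=> M0; eexists; apply: (@quotient_cover (klein_equiv R) (-1) _ _ M M0).
  by right.
by move=> p q; split => [/asboolP//|h]; apply/asboolP.
Qed.

End Covers.

(** * The prism: cubic and 3-connected *)

Section Prism.
Variable m : nat.
Local Notation M := m.+3.
Local Notation column := 'I_M.

Definition prism_edge : rel (column * bool) := fun p q =>
  (p.2 == q.2) && ((q.1 == p.1 + 1) || (p.1 == q.1 + 1)) ||
  (p.1 == q.1) && (p.2 != q.2).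

Lemma prism_edge_sym : symmetric prism_edge.
Proof.
move=> p q; rewrite /prism_edge ![q.2 == _]eq_sym [q.1 == p.1]eq_sym.
by rewrite [(p.1 == _) || _]orbC.
Qed.

Lemma prism_edge_irrefl : irreflexive prism_edge.
Proof.
move=> p; rewrite /prism_edge !eqxx /= orbF orbb.
by rewrite -[X in X == _]addr0 (inj_eq (addrI _)) eq_sym oner_eq0.
Qed.

Definition prism : sgraph := SGraph prism_edge_sym prism_edge_irrefl.

Lemma columnE (c : column) : c = (c : nat)%:R :> column.
Proof. by rewrite natr_Zp. Qed.

Lemma val_columnE (k : nat) : (k%:R : column) = (k %% M)%N :> nat.
Proof. exact: (@val_Zp_nat M). Qed.

Lemma natr_column_eq0 (k : nat) : ((k%:R : column) == 0) = (M %| k)%N.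
Proof. by rewrite -(inj_eq val_inj) /= val_columnE. Qed.

Lemma val_columnN1 : (-1 : column) = m.+2 :> nat.
Proof.
have -> : (-1 : column) = m.+2%:R.
  by apply/eqP; rewrite eq_sym -subr_eq0 opprK natr1 natr_column_eq0 dvdnn.
by rewrite val_columnE modn_small.
Qed.

Lemma val_column1 (c : column) :
  (c + 1 : column) = (if c == -1 then 0%N else c.+1) :> nat.
Proof.
have cM := ltn_ord c; rewrite {1}(columnE c) natr1 val_columnE.
have [->|ne] := eqVneq c (-1); first by rewrite val_columnN1 modnn.
rewrite modn_small //; have [cE|/eqP ne'] := eqVneq (c : nat) m.+2; last by lia.
case/eqP: ne; apply/eqP; rewrite -subr_eq0 opprK (columnE c) cE natr1.
by rewrite natr_column_eq0 dvdnn.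
Qed.

Lemma column_addn_neq (a : column) (i : nat) :
  (0 < i < M)%N -> a + i%:R != a.
Proof.
move=> i0; rewrite -[X in _ != X]addr0 (inj_eq (addrI _)) natr_column_eq0.
by rewrite gtnNdvd; lia.
Qed.

Lemma column_succ_neq (a : column) : a + 1 != a.
Proof. by have := @column_addn_neq a 1; apply. Qed.

Lemma column_succ2_neq (a : column) : a + 1 + 1 != a.
Proof. by rewrite -addrA; have := @column_addn_neq a 2; apply. Qed.

Lemma edge_rail (c : column) s : edge (s := prism) (c, s) (c + 1, s).
Proof. by rewrite /edge /= /prism_edge /= !eqxx. Qed.

Lemma edge_rung (c : column) s : edge (s := prism) (c, s) (c, ~~ s).
Proof. by rewrite /edge /= /prism_edge /= eqxx; case: s. Qed.

Lemma prism_edgeP (p q : vertex prism) : edge p q ->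
  [\/ q = (p.1 + 1, p.2), p = (q.1 + 1, q.2) | q = (p.1, ~~ p.2)].
Proof.
case: p q => c s [d r]; rewrite /edge /= /prism_edge /=.
case/orP => [/andP[/eqP-> /orP[/eqP->|/eqP->]]|/andP[/eqP-> sr]].
- exact: Or31.
- exact: Or32.
- by apply: Or33; case: s r sr => [] [].
Qed.

Lemma prism_cubic : cubic prism.
Proof.
move=> [c s]; rewrite (_ : [set u | _]%SET =
  ((c + 1, s) |: ((c - 1, s) |: [set (c, ~~ s)]))%SET :> {set column * bool}).
  rewrite !cardsU1 cards1 !inE !xpair_eqE eqxx andbT.
  have -> : (s == ~~ s) = false by case: (s).
  rewrite !andbF !orbF (_ : (c + 1 == c - 1) = false) //.
  by apply/negbTE; have := column_succ2_neq (c - 1); rewrite subrK.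
apply/setP => -[d r]; rewrite !inE; apply/idP/idP.
  move=> /prism_edgeP[] /= [-> ->]; rewrite ?eqxx ?orbT //.
  by rewrite addrK eqxx orbT.
case/or3P => /eqP[-> ->]; first exact: edge_rail.
  by have := edge_rail (c - 1) s; rewrite subrK edge_sym.
exact: edge_rung.
Qed.

Lemma exists_column_notin (A : {set column}) : (#|A| < 3)%N ->
  exists c, c \notin A.
Proof.
move=> A3; have : (0 < #|~: A|)%N.
  by rewrite -subn_gt0 in A3; have := cardsC A; rewrite card_ord; lia.
by case/card_gt0P => c; rewrite inE => h; exists c.
Qed.

Section Delete.
Variable X : {set vertex prism}.
Local Notation del := (connect (delete_edge X)).

Lemma delete_connect_sym : connect_sym (delete_edge X).
Proof.
apply: sym_connect_sym => u v; rewrite /delete_edge edge_sym.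
by rewrite andbCA.
Qed.

(** Without the column [a] a rail is a path, run through here from [a + 1]. *)
Lemma rail_connected_avoiding s a c c' :
  (forall d, d != a -> (d, s) \notin X) -> c != a -> c' != a ->
  del (c, s) (c', s).
Proof.
move=> aX; suff h d : d != a -> del (a + 1, s) (d, s).
  by move=> ca c'a; apply: connect_trans (h _ c'a); rewrite delete_connect_sym;
    apply: h.
have step i : (i < m.+2)%N -> del (a + 1, s) (a + 1 + i%:R, s).
  elim: i => [|i IH] im; first by rewrite addr0.
  apply: connect_trans (IH (ltnW im)) _; apply: connect1.
  have ne k : (k < m.+2)%N -> a + 1 + k%:R != a.
    by move=> km; rewrite -addrA nat1r column_addn_neq //; lia.
  rewrite /delete_edge (aX _ (ne _ im)) (aX _ (ne _ (ltnW im))) /=.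
  by rewrite -natr1 addrA; exact: edge_rail.
move=> da; pose k : column := d - (a + 1).
have dE : d = a + 1 + (k : nat)%:R by rewrite -columnE addrC subrK.
rewrite dE; apply: step; have := ltn_ord k; rewrite ltnS leq_eqVlt.
case/orP => // /eqP kE; case/eqP: da; rewrite dE kE -addrA nat1r.
by apply/eqP; rewrite -subr_eq0 [a + _]addrC addrK natr_column_eq0 dvdnn.
Qed.

Lemma rail_connected s c c' : (#|[set d | (d, s) \in X]%SET| <= 1)%N ->
  (c, s) \notin X -> (c', s) \notin X -> del (c, s) (c', s).
Proof.
set Xs := [set d | _]%SET => X1 cX c'X.
have [X0|[a]] := set_0Vmem Xs.
  have [|a] := @exists_column_notin [set c; c']%SET.
    by rewrite cards2; case: (_ == _).
  rewrite !inE negb_or ![a == _]eq_sym => /andP[ca c'a].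
  apply: (@rail_connected_avoiding s a) => // d _.
  by apply/negP => dX; have := finset.in_set0 d; rewrite -X0 inE dX.
move=> aX; apply: (@rail_connected_avoiding s a) => [d da||].
- apply: contra da => dX; apply/eqP; have /card_le1P := X1.
  move=> /(_ a aX) h; have : d \in Xs by rewrite inE.
  by rewrite h !inE => /eqP.
- by apply: contra cX => /eqP->; move: aX; rewrite inE.
- by apply: contra c'X => /eqP->; move: aX; rewrite inE.
Qed.

End Delete.

(** Two deleted vertices either lie on one rail, and the other rail stays
intact with all its rungs, or leave each rail a path, and some rung joins the
two paths. *)
Lemma prism_3connected : vertex_connected 3 prism.
Proof.
split; first by rewrite card_prod card_ord card_bool; lia.
move=> X X3; pose Xs s := [set d | (d, s) \in X]%SET.
have cX : (#|Xs false| + #|Xs true| <= 2)%N.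
  have <- : #|(fun d => (d, false)) @: Xs false|%SET = #|Xs false|.
    by apply: card_imset => d d' [].
  have <- : #|(fun d => (d, true)) @: Xs true|%SET = #|Xs true|.
    by apply: card_imset => d d' [].
  rewrite -cardsUI (_ : _ :&: _ = finset.set0)%SET ?cards0 ?addn0.
    rewrite -ltnS; apply: leq_ltn_trans X3; apply: subset_leq_card.
    rewrite finset.subUset; apply/andP.
    by split; apply/fintype.subsetP => _ /imsetP[d + ->]; rewrite inE.
  by apply/setP => -[d s]; rewrite !inE;
    apply/andP => -[/imsetP[? _ [_ ->]] /imsetP[? _ []]].
have intact s : Xs s = finset.set0 -> forall u v, u \notin X -> v \notin X ->
    connect (delete_edge X) u v.
  move=> X0; have sX d : (d, s) \notin X.
    by apply/negP => dX; have := finset.in_set0 d; rewrite -X0 inE dX.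
  suff h u : u \notin X -> connect (delete_edge X) u (0, s).
    move=> u v uX vX; apply: connect_trans (h _ uX) _.
    by rewrite delete_connect_sym; apply: h.
  move=> uX; apply: (@connect_trans _ _ (u.1, s)); last first.
    by apply: rail_connected => //; rewrite -/(Xs s) X0 cards0.
  case: u uX => d r uX; have [->|rs] := eqVneq r s; first exact: connect0.
  apply: connect1; rewrite /delete_edge uX sX /=.
  have -> : s = ~~ r by move: rs; case: (r); case: (s).
  exact: edge_rung.
have [/intact//|[a0 a0X]] := set_0Vmem (Xs false).
have [/intact//|[a1 a1X]] := set_0Vmem (Xs true).
have c0 : (0 < #|Xs false|)%N by apply/card_gt0P; exists a0.
have c1 : (0 < #|Xs true|)%N by apply/card_gt0P; exists a1.
have cs s : (#|Xs s| <= 1)%N by case: s; lia.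
have [|e] := @exists_column_notin (Xs false :|: Xs true)%SET.
  by apply: leq_ltn_trans (leq_card_setU _ _) _; rewrite ltnS; exact: cX.
rewrite !inE negb_or => /andP[e0 e1].
have es s : (e, s) \notin X by case: s.
suff h u : u \notin X -> connect (delete_edge X) u (e, false).
  move=> u v uX vX; apply: connect_trans (h _ uX) _.
  by rewrite delete_connect_sym; apply: h.
case: u => d [] uX; last exact: rail_connected (cs _) uX (es _).
apply: (@connect_trans _ _ (e, true));
  first exact: rail_connected (cs _) uX (es _).
by apply: connect1; rewrite /delete_edge !es; exact: edge_rung.
Qed.

End Prism.

(** * Drawing the prism along given curves *)

Section Drawing.
Variables (R : realType) (m : nat).
Local Notation M := m.+3.
Local Notation column := 'I_M.
Local Notation V := (vertex (prism m)).

(** Positions along the edges; each point of the realization has exactly one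
proper site, vertices being counted on their rail with parameter 0. *)
Inductive site := OnRail (s : bool) (c : column) (t : R)
  | OnRung (c : column) (t : R).

Definition proper_site (p : site) : bool := match p with
  | OnRail _ _ t => 0 <= t < 1
  | OnRung _ t => 0 < t < 1
  end.

Definition site_point (p : site) : {ptws V -> R} := match p with
  | OnRail s c t => edge_point (G := prism m) (c, s) (c + 1, s) t
  | OnRung c t => edge_point (G := prism m) (c, false) (c, true) t
  end.

Lemma edge_point_support (u v w : V) (t : R) :
  edge_point u v t w != 0 -> (w == u) || (w == v).
Proof.
rewrite edge_pointE; have [->|] := eqVneq w u; first by [].
by have [->|] := eqVneq w v; rewrite ?orbT // !mulr0 addr0 eqxx.
Qed.

Lemma edge_point_src (u v : V) (t : R) : u != v -> edge_point u v t u = 1 - t.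
Proof.
by move=> uv; rewrite edge_pointE eqxx (negbTE uv) mulr0 addr0 mulr1.
Qed.

Lemma rail_neq s (c : column) : (c, s) != (c + 1, s) :> V.
Proof. by rewrite xpair_eqE eqxx andbT eq_sym column_succ_neq. Qed.

Lemma rung_neq (c : column) : (c, false) != (c, true) :> V.
Proof. by rewrite xpair_eqE andbF. Qed.

Lemma rail_rung_site s (c d : column) (t x : R) : 0 < x < 1 ->
  site_point (OnRail s c t) <> site_point (OnRung d x).
Proof.
move=> x01 E.
have h r : ((d, r) == (c, s)) || ((d, r) == (c + 1, s)).
  apply: (@edge_point_support _ _ _ t);
    rewrite -/(site_point (OnRail s c t)) E /=.
  case: r; first by rewrite edge_point_tgt ?rung_neq //; lra.
  by rewrite edge_point_src ?rung_neq //; lra.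
by have := h (~~ s); rewrite !xpair_eqE; case: (s); rewrite !andbF.
Qed.

Lemma site_point_inj p q : proper_site p -> proper_site q ->
  site_point p = site_point q -> p = q.
Proof.
case: p q => [s c t|c t] [r d x|d x] /= t01 x01 E; last first.
- have tx : t = x.
    have := congr1 (fun f : {ptws V -> R} => f (c, true)) E.
    rewrite /= edge_point_tgt ?rung_neq // => tE.
    have : edge_point (G := prism m) (d, false) (d, true) x (c, true) != 0.
      by rewrite -tE; lra.
    move/edge_point_support; rewrite !xpair_eqE andbF andbT /= => /eqP cd.
    by move: tE; rewrite cd edge_point_tgt ?rung_neq.
  rewrite tx; congr OnRung; move: x01; rewrite -tx => _.
  have : edge_point (G := prism m) (d, false) (d, true) x (c, true) != 0.
    by rewrite -E edge_point_tgt ?rung_neq //; lra.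
  by move/edge_point_support; rewrite !xpair_eqE andbF andbT /= => /eqP.
- by case: (@rail_rung_site r d c x t) => //; rewrite /= E.
- by case: (@rail_rung_site s c d t x) => //; rewrite /= E.
have h1 : edge_point (G := prism m) (d, r) (d + 1, r) x (c, s) != 0.
  by rewrite -E edge_point_src ?rail_neq //; lra.
have h2 : edge_point (G := prism m) (c, s) (c + 1, s) t (d, r) != 0.
  by rewrite E edge_point_src ?rail_neq //; lra.
move/edge_point_support: h1; move/edge_point_support: h2.
rewrite !xpair_eqE -!andb_orl => /andP[dc _] /andP[cd /eqP sr].
have cdE : c = d.
  case/orP: dc => [/eqP->//|/eqP dE]; case/orP: cd => [/eqP//|/eqP cE].
  by move: (column_succ2_neq c); rewrite -dE -cE eqxx.
rewrite -cdE -sr in E *; congr OnRail.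
have := congr1 (fun f : {ptws V -> R} => f (c, s)) E.
by rewrite /= !edge_point_src ?rail_neq //; lra.
Qed.

Section Curves.
Variables (S : topologicalType) (rail : bool -> column -> R -> S)
  (rung : column -> R -> S).
Hypothesis rail_cont : forall s c, continuous (rail s c).
Hypothesis rung_cont : forall c, continuous (rung c).
Hypothesis rail_next : forall s c, rail s c 1 = rail s (c + 1) 0.
Hypothesis rung_ends : forall c (s : bool), rung c s%:R = rail s c 0.

Definition site_image (p : site) : S := match p with
  | OnRail s c t => rail s c t
  | OnRung c t => rung c t
  end.

Definition drawing (x : {ptws V -> R}) : S :=
  if pselect (exists p, proper_site p /\ site_point p = x) is left ex
  then site_image (projT1 (cid ex))
  (* any value will do off the realization *)
  else rail false 0 0.

Lemma drawing_site p : proper_site p -> drawing (site_point p) = site_image p.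
Proof.
move=> pp; rewrite /drawing; case: pselect => [ex|[]]; last by exists p.
by congr site_image; case: cid => q /= [pq E]; exact: site_point_inj.
Qed.

Lemma rail_site s c t : 0 <= t <= 1 -> exists p, [/\ proper_site p,
  site_point p = edge_point (G := prism m) (c, s) (c + 1, s) t &
  site_image p = rail s c t].
Proof.
case/andP => t0; rewrite le_eqVlt => /orP[/eqP->|t1].
  exists (OnRail s (c + 1) 0); split; rewrite /= ?lexx ?ltr01 //.
  by apply: funext => w; rewrite !edge_pointE; ring.
by exists (OnRail s c t); split; rewrite /= ?t0.
Qed.

Lemma rung_site c t : 0 <= t <= 1 -> exists p, [/\ proper_site p,
  site_point p = edge_point (G := prism m) (c, false) (c, true) t &
  site_image p = rung c t].
Proof.
case/andP; rewrite le_eqVlt => /orP[/eqP<- _|t0].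
  exists (OnRail false c 0); split; rewrite /= ?lexx ?ltr01 //.
    by apply: funext => w; rewrite !edge_pointE; ring.
  by rewrite -(rung_ends c false).
rewrite le_eqVlt => /orP[/eqP->|t1].
  exists (OnRail true c 0); split; rewrite /= ?lexx ?ltr01 //.
    by apply: funext => w; rewrite !edge_pointE; ring.
  by rewrite -(rung_ends c true).
by exists (OnRung c t); split; rewrite /= ?t0.
Qed.

Lemma drawing_rail s c t : 0 <= t <= 1 ->
  drawing (edge_point (G := prism m) (c, s) (c + 1, s) t) = rail s c t.
Proof. by move=> /(rail_site s c)[p [pp <- <-]]; exact: drawing_site. Qed.

Lemma drawing_rung c t : 0 <= t <= 1 ->
  drawing (edge_point (G := prism m) (c, false) (c, true) t) = rung c t.
Proof. by move=> /(rung_site c)[p [pp <- <-]]; exact: drawing_site. Qed.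

Lemma realization_site x : realization x ->
  exists2 p, proper_site p & site_point p = x.
Proof.
move=> [u [v [t [uv t01 ->]]]].
have t01' : 0 <= 1 - t <= 1 by lra.
case: uv => [<-|/prism_edgeP].
  exists (OnRail u.2 u.1 0); first by rewrite /= lexx ltr01.
  by case: u => c s; apply: funext => w; rewrite /= !edge_pointE; ring.
case: u v => c s [d r] /= [[-> ->]|[-> ->]|[-> ->]].
- by have [p [pp E _]] := rail_site s c t01; exists p.
- have [p [pp E _]] := rail_site r d t01'; exists p => //.
  by rewrite E [RHS]edge_point_sym.
- case: s.
    have [p [pp E _]] := rung_site c t01'; exists p => //.
    by rewrite E [RHS]edge_point_sym.
  by have [p [pp E _]] := rung_site c t01; exists p.
Qed.

Lemma drawing_embedding :
  (forall p q, proper_site p -> proper_site q -> site_image p = site_image q ->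
    p = q) ->
  {within @realization R (prism m), continuous drawing} /\
  {in @realization R (prism m) &, injective drawing}.
Proof.
move=> inj; split; last first.
  move=> x y; rewrite !inE => /realization_site[p pp <-].
  move=> /realization_site[q qq <-]; rewrite !drawing_site // => /inj-> //.
apply: realization_continuous => [[c s]|u v].
  by exists (c + 1, s); exact: edge_rail.
have flip (g : R -> S) : continuous g -> continuous (fun t : R => g (1 - t)).
  move=> cg; apply: comp_cont cg; apply: add_cont; first exact: cst_cont.
  by apply: opp_cont => x; exact: cvg_id.
have t01' (t : R) : 0 <= t <= 1 -> 0 <= 1 - t <= 1 by lra.
move/prism_edgeP; case: u v => c s [d r] /= [[-> ->]|[-> ->]|[-> ->]].
- by exists (rail s c) => // t; exact: drawing_rail.
- exists (fun t => rail r d (1 - t)) => [|t t01]; first exact: flip.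
  by rewrite edge_point_sym drawing_rail // t01'.
- case: s; last by exists (rung c) => // t; exact: drawing_rung.
  exists (fun t => rung c (1 - t)) => [|t t01]; first exact: flip.
  by rewrite edge_point_sym drawing_rung // t01'.
Qed.

Lemma drawing_image : drawing @` @realization R (prism m) =
  [set z | exists2 p, proper_site p & z = site_image p].
Proof.
rewrite predeqE => z; split => [[x /realization_site[p pp <-] <-]|[p pp ->]].
  by exists p => //; rewrite drawing_site.
exists (site_point p); last exact: drawing_site.
case: p pp => [s c t|c t] /= t01.
  exists (c, s), (c + 1, s), t; split => //; last by lra.
  by right; exact: edge_rail.
exists (c, false), (c, true), t; split => //; last by lra.
by right; exact: edge_rung.
Qed.

End Curves.

(** The prism is drawn in the plane as a ladder between the lines of ordinates
0 and 1; the two edges closing the rails bulge outside this strip. *)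
Lemma prism_planar : planar R (prism m).
Proof.
pose bulge (c : column) : R := (c == -1)%:R.
pose rail (s : bool) (c : column) (t : R) : R * R :=
  ((1 - t) * c%:R + t * ((c + 1)%R : nat)%:R,
   s%:R + (-1) ^+ (~~ s) * (bulge c * (t * (1 - t)))).
pose rung (c : column) (t : R) : R * R := (c%:R, t).
have cid : continuous (fun t : R => t) by move=> t; exact: cvg_id.
have c1 : continuous (fun t : R => 1 - t).
  by apply: add_cont; [exact: cst_cont | exact: opp_cont].
have [|||||cb ib] := @drawing_embedding _ rail rung;
  last by exists (drawing rail rung).
- move=> s c; apply: pair_cont.
    by apply: add_cont; apply: mul_cont => //; exact: cst_cont.
  apply: add_cont; first exact: cst_cont.
  apply: mul_cont; first exact: cst_cont.
  by apply: mul_cont; [exact: cst_cont | exact: mul_cont].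
- by move=> c; apply: pair_cont => //; exact: cst_cont.
- by move=> s c; rewrite /rail; congr pair; ring.
- by move=> c s; rewrite /rail /rung; congr pair; ring.
have natI (c d : column) (t x : R) : c%:R + t = d%:R + x ->
    0 <= t < 1 -> 0 <= x < 1 -> c = d /\ t = x.
  move=> E t01 x01; have cd : c = d.
    apply: val_inj => /=; have [h|h|//] := ltngtP (c : nat) (d : nat).
      by exfalso; move: h; rewrite -(ler_nat R) -natr1; lra.
    by exfalso; move: h; rewrite -(ler_nat R) -natr1; lra.
  by split => //; move: E; rewrite cd; lra.
have bulge_ge0 (c : column) (t : R) : 0 <= t < 1 -> 0 <= bulge c * (t * (1 -
  t)).
  by move=> t01; rewrite mulr_ge0 ?ler0n // mulr_ge0 //; lra.
have side s c (t : R) : 0 <= t < 1 -> if s then 1 <= (rail s c t).2 else (rail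
  s c t).2 <= 0.
  move=> t01; have := bulge_ge0 c t t01.
  by case: s; rewrite /rail /= ?expr0 ?expr1 ?mul1r ?mulN1r; lra.
have rail_rung s c d (t x : R) : 0 <= t < 1 -> 0 < x < 1 -> rail s c t <> rung
  d x.
  move=> t01 x01 E; have := side s c t t01; rewrite E /rung /=.
  by case: s {E}; lra.
move=> [s c t|c t] [r d x|d x] /= t01 x01 E.
- have sr : s = r.
    have := side s c t t01; have := side r d x x01; rewrite E.
    by case: s r {E} => [] []//; lra.
  have E1 : (1 - t) * c%:R + t * ((c + 1)%R : nat)%:R =
            (1 - x) * d%:R + x * ((d + 1)%R : nat)%:R := congr1 fst E.
  have : s%:R + (-1) ^+ (~~ s) * (bulge c * (t * (1 - t))) =
         r%:R + (-1) ^+ (~~ r) * (bulge d * (x * (1 - x))) := congr1 snd E.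
  have sgn0 : (-1) ^+ (~~ r) != 0 :> R by case: (r); rewrite ?expr1 ?expr0; lra.
  rewrite sr => /addrI /(mulfI sgn0); rewrite /bulge.
  rewrite !val_column1 in E1.
  have pos (y : R) : 0 <= y < 1 -> y * (1 - y) = 0 -> y = 0.
    by move=> y01 /eqP; rewrite mulf_eq0 => /orP[/eqP//|/eqP]; lra.
  have low (e : column) : e != -1 -> (e : nat).+1%:R <= m.+2%:R :> R.
    move=> ne; rewrite ler_nat ltn_neqAle -ltnS ltn_ord andbT.
    by apply: contra ne => /eqP; rewrite -[RHS]val_columnN1 => /val_inj->.
  move: E1; have [->|cn] := eqVneq c (-1); have [->|dn] := eqVneq d (-1);
    rewrite ?mul1r ?mul0r ?mulr0 ?addr0 => E1 E2.
  + move: E1; rewrite val_columnN1 => /(mulIf _); rewrite pnatr_eq0 => /(_ isT).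
    by move=> tx; congr OnRail; lra.
  + have t0 := pos _ t01 E2; move: E1 (low _ dn); rewrite val_columnN1 t0.
    by rewrite -!natr1 => *; exfalso; lra.
  + have x0 := pos _ x01 (esym E2); move: E1 (low _ cn);
    rewrite val_columnN1 x0.
    by rewrite -!natr1 => *; exfalso; lra.
  + have [|||-> ->] // := natI c d t x.
    by move: E1; rewrite -!natr1; lra.
- by case: (rail_rung s c d t x).
- by case: (rail_rung r d c x t).
- by case: E => /eqP; rewrite eqr_nat => /eqP/val_inj-> ->.
Qed.

End Drawing.

(** * Piecewise linear interpolation of a sign sequence *)

Section Interpolation.
Variables (R : realType) (sg : int -> R).
Hypothesis sg1 : forall z, sg z = 1 \/ sg z = -1.

Definition interp (x : R) : R :=
  let z := Num.floor x in let t := x - z%:~R in (1 - t) * sg z + t * sg (z + 1).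

Lemma interp_segment (z : int) (t : R) : 0 <= t <= 1 ->
  interp (z%:~R + t) = (1 - t) * sg z + t * sg (z + 1).
Proof.
case/andP => t0; rewrite le_eqVlt => /orP[/eqP->|t1]; last first.
  rewrite /interp (@floor_def _ _ z); last by rewrite intrD; lra.
  by ring.
rewrite /interp (@floor_def _ _ (z + 1)); last by rewrite !intrD; lra.
by rewrite intrD subrr subr0; ring.
Qed.

Lemma interp_int (z : int) : interp z%:~R = sg z.
Proof.
have := @interp_segment z 0; rewrite addr0 => ->; last by lra.
by ring.
Qed.

Lemma interp_bound x : -1 <= interp x <= 1.
Proof.
have /andP[f0 f1] := floor_itv x; rewrite intrD in f1; rewrite /interp.
set z := Num.floor x in f0 f1 *.
case: (sg1 z) => ->; case: (sg1 (z + 1)) => ->; lra.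
Qed.

(** The slope is at most 2 on each unit segment, and the range has diameter at
most 2, so only points in the same or in adjacent segments matter. *)
Lemma interp_lipschitz (x y : R) : `|interp x - interp y| <= 2 * `|x - y|.
Proof.
wlog xy : x y / x <= y.
  move=> h; have [/h//|/ltW/h] := leP x y.
  by rewrite distrC [`|x - y|]distrC.
have := interp_bound x; have := interp_bound y.
rewrite [`|x - y|]distrC (ger0_norm (_ : 0 <= y - x)) ?subr_ge0 //.
have /andP[f0 f1] := floor_itv x; rewrite intrD in f1.
set z := Num.floor x in f0 f1 *.
have step (w : int) (u v : R) : w%:~R <= u -> u <= v -> v <= w%:~R + 1 ->
    - (2 * (v - u)) <= interp u - interp v <= 2 * (v - u).
  move=> wu uv vw; rewrite -[u](subrK w%:~R) -[v](subrK w%:~R).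
  rewrite ![_ + w%:~R]addrC !interp_segment; try lra.
  case: (sg1 w) => ->; case: (sg1 (w + 1)) => ->; lra.
rewrite ler_norml => b1 b2; have [yz|zy] := leP y (z%:~R + 1).
  by have := step z x y f0 xy yz; lra.
have [yz2|zy2] := leP y (z%:~R + 1 + 1); last by lra.
have := step z x (z%:~R + 1) f0 (ltW f1) (lexx _).
have := step (z + 1) (z%:~R + 1) y; rewrite intrD => /(_ (lexx _) (ltW zy) yz2).
lra.
Qed.

Lemma interp_cont : continuous interp.
Proof.
move=> x; apply/cvgrPdist_le => /= eps e0; near=> y.
apply: le_trans (interp_lipschitz x y) _; rewrite mulrC -ler_pdivlMr //.
near: y; apply: (@cvgr_dist_le _ _ _ _ _ id x); first exact: cvg_id.
by rewrite divr_gt0.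
Unshelve. all: by end_near.
Qed.

Lemma interp_shift (e : R) (d : int) :
  (forall z, sg (z + d) = e * sg z) -> forall x,
    interp (x + d%:~R) = e * interp x.
Proof.
move=> sgd x; rewrite /interp.
rewrite (@floor_def _ (x + d%:~R) (Num.floor x + d)); last first.
  by have := floor_itv x; rewrite !intrD; lra.
rewrite (_ : Num.floor x + d + 1 = Num.floor x + 1 + d); last by ring.
by rewrite !sgd intrD; ring.
Qed.

End Interpolation.

(** * The boundary of the square as a loop *)

Section SquareLoop.
Variables (R : realType) (J : R).
Hypothesis J0 : 0 < J.

Definition clamp (x : R) : R := Num.max 0 (Num.min 1 x).

Lemma clamp0 (x : R) : x <= 0 -> clamp x = 0.
Proof.
move=> x0; rewrite /clamp min_r; last by lra.
by rewrite max_l.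
Qed.

Lemma clamp1 (x : R) : 1 <= x -> clamp x = 1.
Proof. by move=> x1; rewrite /clamp min_l // max_r. Qed.

Lemma clamp_id (x : R) : 0 <= x <= 1 -> clamp x = x.
Proof. by move=> /andP[x0 x1]; rewrite /clamp min_r // max_r. Qed.

Lemma clamp_cont (T : topologicalType) (f : T -> R) :
  continuous f -> continuous (fun x => clamp (f x)).
Proof.
by move=> cf; apply: max_cont; [|apply: min_cont => //]; exact: cst_cont.
Qed.

(** The boundary of the square $[-1,1]^2$, run through counterclockwise from
its lower left corner in time [2 * J + 2]: the horizontal sides take time [J],
the vertical ones time 1. *)
Definition square_loop (x : R) : R * R :=
  (- 1 + 2 * clamp (x / J) - 2 * clamp ((x - J - 1) / J),
   - 1 + 2 * clamp (x - J) - 2 * clamp (x - 2 * J - 1)).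

Lemma square_loop_cont : continuous square_loop.
Proof.
have cid : continuous (fun x : R => x) by move=> x; exact: cvg_id.
have aff (f : R -> R) (u v : R) : (forall x, f x = x * u + v) ->
    continuous (fun x => clamp (f x)).
  move=> /funext->; apply: clamp_cont; apply: add_cont; last exact: cst_cont.
  by apply: mul_cont => //; exact: cst_cont.
have lin (f g : R -> R) : continuous f -> continuous g ->
    continuous (fun x => - 1 + 2 * f x - 2 * g x).
  move=> cf cg; apply: add_cont; last first.
    by apply: opp_cont; apply: mul_cont => //; exact: cst_cont.
  apply: add_cont; first exact: cst_cont.
  by apply: mul_cont => //; exact: cst_cont.
apply: pair_cont; apply: lin.
- by apply: (aff _ J^-1 0) => y; ring.
- by apply: (aff _ J^-1 ((- J - 1) / J)) => y; ring.
- by apply: (aff _ 1 (- J)) => y; ring.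
- by apply: (aff _ 1 (- (2 * J) - 1)) => y; ring.
Qed.

Lemma square_loop_bottom (u : R) : 0 <= u <= 1 -> square_loop (J * u) = (- 1 +
  2 * u, -1).
Proof.
have Jp := J0; move=> u01; have Ju : J * u <= J by nra.
have Ju' : J * u - J <= 0 by lra.
rewrite /square_loop [J * u]mulrC mulfK ?gt_eqF // [u * J]mulrC (clamp_id u01).
rewrite (clamp0 Ju') (@clamp0 (J * u - 2 * J - 1)); last by lra.
rewrite clamp0; last by rewrite pmulr_lle0 ?invr_gt0 //; lra.
by congr pair; ring.
Qed.

Lemma square_loop_right (u : R) : 0 <= u <= 1 -> square_loop (J + u) = (1,
  - 1 + 2 * u).
Proof.
have Jp := J0; move=> u01; rewrite /square_loop clamp1;
  last by rewrite ler_pdivlMr //; lra.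
rewrite clamp0; last by rewrite pmulr_lle0 ?invr_gt0 //; lra.
rewrite [J + u]addrC addrK (clamp_id u01) clamp0; last by lra.
by congr pair; ring.
Qed.

Lemma square_loop_top (u : R) : 0 <= u <= 1 ->
  square_loop (J + 1 + J * u) = (1 - 2 * u, 1).
Proof.
have Jp := J0; move=> u01; have Ju : 0 <= J * u by apply: mulr_ge0; lra.
have Ju' : J * u <= J by nra.
rewrite /square_loop clamp1; last by rewrite ler_pdivlMr //; lra.
have -> : J + 1 + J * u - J - 1 = u * J by ring.
rewrite mulfK ?gt_eqF // (clamp_id u01) clamp1; last by lra.
rewrite clamp0; last by lra.
by congr pair; ring.
Qed.

Lemma square_loop_left (u : R) : 0 <= u <= 1 ->
  square_loop (2 * J + 1 + u) = (-1, 1 - 2 * u).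
Proof.
have Jp := J0; move=> u01; rewrite /square_loop clamp1;
  last by rewrite ler_pdivlMr //; lra.
rewrite clamp1; last by rewrite ler_pdivlMr //; lra.
have -> : 2 * J + 1 + u - 2 * J - 1 = u by ring.
rewrite (clamp_id u01) clamp1; last by lra.
by congr pair; ring.
Qed.

Lemma square_loop_sides (x : R) : 0 <= x < 2 * J + 2 -> exists2 u : R,
  0 <= u < 1 &
  [\/ x = J * u, x = J + u | x = J + 1 + J * u \/ x = 2 * J + 1 + u].
Proof.
have Jp := J0; have h y : 0 <= y < J -> exists2 u : R, 0 <= u < 1 & y = J * u.
  move=> /andP[y0 y1]; exists (y / J).
    by rewrite divr_ge0 ?(ltW J0) // ltr_pdivrMr // mul1r.
  by rewrite mulrC divfK // gt_eqF.
move=> x01; have [xJ|xJ] := ltP x J.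
  by have [|u u01 uE] := h x; [lra | exists u => //; apply: Or31].
have [xJ1|xJ1] := ltP x (J + 1).
  by exists (x - J); [lra | apply: Or32; ring].
have [xJ2|xJ2] := ltP x (2 * J + 1).
  have [|u u01 uE] := h (x - (J + 1)); first by lra.
  by exists u => //; apply: Or33; left; rewrite -uE; ring.
by exists (x - (2 * J + 1)); [lra | apply: Or33; right; ring].
Qed.

Lemma square_loop_inj (x y : R) : 0 <= x < 2 * J + 2 -> 0 <= y < 2 * J + 2 ->
  square_loop x = square_loop y -> x = y.
Proof.
move=> /square_loop_sides[u /andP[u0 u1] ux] /square_loop_sides[v /andP[v0 v1]
  vy].
have u01 : 0 <= u <= 1 by lra.
have v01 : 0 <= v <= 1 by lra.
have E := (square_loop_bottom u01, square_loop_right u01, square_loop_top u01,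
  square_loop_left u01, square_loop_bottom v01, square_loop_right v01,
  square_loop_top v01, square_loop_left v01).
have J_neq0 : J != 0 by rewrite gt_eqF.
case: ux => [->|->|[->|->]]; case: vy => [->|->|[->|->]];
  rewrite !E => /pair_equal_spec[h1 h2];
  try (by exfalso; lra); by rewrite (_ : u = v) //; lra.
Qed.

Lemma square_loop_norm (x : R) : 0 <= x < 2 * J + 2 -> norm_sup (square_loop x)
  = 1.
Proof.
move=> /square_loop_sides[u /andP[u0 u1] ux].
have u01 : 0 <= u <= 1 by lra.
have b : `|- 1 + 2 * u| <= 1 by rewrite ler_norml; lra.
have b' : `|1 - 2 * u| <= 1 by rewrite ler_norml; lra.
have E := (square_loop_bottom u01, square_loop_right u01, square_loop_top u01,
  square_loop_left u01).
by case: ux => [->|->|[->|->]];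
  rewrite E /norm_sup /= ?normrN normr1 ?(max_l b) ?(max_r b) ?(max_l b')
  ?(max_r b').
Qed.

Lemma square_loop_end : square_loop (2 * J + 2) = square_loop 0.
Proof.
have z01 : 0 <= (0 : R) <= 1 by lra.
have o01 : 0 <= (1 : R) <= 1 by lra.
rewrite (_ : 2 * J + 2 = 2 * J + 1 + 1); last by ring.
rewrite square_loop_left // -[0](mulr0 J) square_loop_bottom //.
by congr pair; ring.
Qed.

Lemma square_loop_surj (q : R * R) : norm_sup q = 1 ->
  exists2 x : R, 0 <= x <= 2 * J + 2 & square_loop x = q.
Proof.
have Jp := J0; case: q => y z; rewrite /norm_sup /= => n1.
have /andP[y0 y1] : -1 <= y <= 1 by rewrite -ler_norml -n1 le_max lexx.
have /andP[z0 z1] : -1 <= z <= 1 by rewrite -ler_norml -n1 le_max lexx orbT.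
have : [\/ y = 1, y = -1 | z = 1 \/ z = -1].
  move: n1; rewrite /Num.max; case: ifP => _ /eqP; rewrite eqr_norml;
    case/andP => /orP[]/eqP-> _;
      [exact/Or33/or_introl|exact/Or33/or_intror| exact: Or31|exact: Or32].
case=> [->|->|[->|->]].
- exists (J + (z + 1) / 2); first by lra.
  by rewrite square_loop_right; [congr pair; field | lra].
- exists (2 * J + 1 + (1 - z) / 2); first by lra.
  by rewrite square_loop_left; [congr pair; field | lra].
- exists (J + 1 + J * ((1 - y) / 2)); first by nra.
  by rewrite square_loop_top; [congr pair; field | lra].
- exists (J * ((y + 1) / 2)); first by nra.
  by rewrite square_loop_bottom; [congr pair; field | lra].
Qed.

End SquareLoop.

(** * The drawing attached to a sign sequence *)

Section SignedDrawing.
Variables (R : realType) (m : nat).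
Local Notation M := m.+3.
Local Notation column := 'I_M.
Variables (S : topologicalType) (e : R) (p : R * R -> S) (sg : int -> R).
Hypothesis e1 : e = 1 \/ e = -1.
Hypothesis cov : plane_cover e M%:R p.
Hypothesis sg1 : forall z, sg z = 1 \/ sg z = -1.
Hypothesis sgM : forall z, sg (z + M%:Z) = e * sg z.
Local Notation a := (interp sg).

Lemma int_trichotomy (n : int) :
  n = 0 \/ n%:~R <= -1 :> R \/ 1 <= n%:~R :> R.
Proof.
have [n0|n0|->] := ltgtP n 0; last by left.
  by right; left; rewrite -[-1]/((-1)%:~R) ler_int; lia.
by right; right; rewrite -[1]/(1%:~R) ler_int; lia.
Qed.

Lemma sg_shift (k z : int) : sg (z + k * M%:Z) = e ^ k * sg z.
Proof.
have ee : e * e = 1 by case: e1 => ->; ring.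
have eu : e \is a GRing.unit by rewrite unitfE; case: e1 => ->; lra.
elim/int_rect: k => [|k IH|k IH] in z *;
  first by rewrite mul0r addr0 expr0z mul1r.
  rewrite intS mulrDl mul1r [_%:Z + _]addrC addrA sgM IH.
  by rewrite exprzDr // expr1z; ring.
rewrite intS opprD mulrDl mulN1r.
have := sgM (z + (- M%:Z + - k%:Z * M%:Z)).
rewrite (_ : z + _ + M%:Z = z + - k%:Z * M%:Z); last by ring.
rewrite IH exprzDr // exprN1 (_ : e^-1 = e) => [E|].
  by rewrite -mulrA E mulrA ee mul1r.
by case: e1 => ->; rewrite ?invr1 ?invrN1.
Qed.

Lemma interp_period (k : int) x : a (x + k%:~R * M%:R) = e ^ k * a x.
Proof.
have -> : k%:~R * M%:R = (k * M%:Z)%:~R :> R by rewrite intrM.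
by apply: interp_shift => // z; exact: sg_shift.
Qed.

(** The rails are mirror images of each other under [y |-> 1/2 - y]. At a column
of sign [s] they have ordinates [s / 8] and [3 * s / 8] modulo 1, and the rung
joins these. *)
Definition rail_height (s : bool) (x : R) : R :=
  if s then 2^-1 - a x / 8 else a x / 8.
Definition rung_height (z : int) (t : R) : R := sg z * (1 / 8 + t / 4).
Definition rail_curve s x : S := p (x, rail_height s x).
Definition rung_curve z t : S := p (z%:~R, rung_height z t).

Lemma rail_curve_period s x (k : int) :
  rail_curve s (x + k%:~R * M%:R) = rail_curve s x.
Proof.
apply/esym/(cover_eq cov); rewrite /rail_height interp_period /=.
have [E|E] := sign_exprz k e1.
  by exists k, 0; rewrite E !mul1r addr0.
rewrite E; case: s; last by exists k, 0; rewrite E addr0; congr pair; ring.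
by exists k, 1; rewrite E; congr pair; field.
Qed.

Lemma rung_curve_period z t (k : int) :
  rung_curve (z + k * M%:Z) t = rung_curve z t.
Proof.
apply/esym/(cover_eq cov); exists k, 0; rewrite /rung_height sg_shift /=.
by rewrite intrD intrM addr0 mulrA.
Qed.

Lemma rail_curve_cont s : continuous (rail_curve s).
Proof.
apply: comp_cont (cover_cont cov); apply: pair_cont; first by move=> x;
  exact: cvg_id.
have ca : continuous (fun x => a x / 8).
  by apply: mul_cont; [exact: interp_cont | exact: cst_cont].
case: s => //; apply: add_cont; [exact: cst_cont | exact: opp_cont].
Qed.

Lemma rung_curve_cont z : continuous (rung_curve z).
Proof.
apply: comp_cont (cover_cont cov); apply: pair_cont; first exact: cst_cont.
apply: mul_cont; first exact: cst_cont.
apply: add_cont; first exact: cst_cont.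
by apply: mul_cont; [move=> x; exact: cvg_id | exact: cst_cont].
Qed.

Lemma rung_curve_end z (s : bool) : rung_curve z s%:R = rail_curve s z%:~R.
Proof.
apply/(cover_eq cov); rewrite /rung_height /rail_height interp_int //=.
case: s => /=; last by exists 0, 0; rewrite mul0r !addr0 expr0z; congr pair;
  field.
by case: (sg1 z) => ->; [exists 0, 0 | exists 0, 1];
  rewrite mul0r !addr0 expr0z;
  congr pair; field.
Qed.

Definition column_of (z : int) : column := z%:~R.

Lemma column_of_nat (z : int) : exists k : int,
  (column_of z : nat)%:Z = z + k * M%:Z.
Proof.
have M0 : (0 : int) < M%:Z by [].
exists (- (z %/ M%:Z)%Z).
have -> : z + - (z %/ M%:Z)%Z * M%:Z = (z %% M%:Z)%Z.
  by rewrite {1}(divz_eq z M%:Z); ring.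
have M_eq0 : (M%:R : column) = 0 by apply/eqP; rewrite natr_column_eq0.
have -> : column_of z = column_of (z %% M%:Z)%Z.
  rewrite /column_of [in LHS](divz_eq z M%:Z) intrD intrM.
  by rewrite -[M%:Z%:~R]/(M%:R) M_eq0 mulr0 add0r.
have := modz_ge0 z (lt0r_neq0 M0); have := ltz_pmod z M0.
case: (z %% M%:Z)%Z => // r rM _.
by rewrite /column_of -[r%:Z%:~R]/(r%:R) val_columnE modn_small.
Qed.

Lemma column_ofD1 z : column_of (z + 1) = column_of z + 1.
Proof. by rewrite /column_of intrD. Qed.

Lemma column_of_eq (z w : int) :
  column_of z = column_of w -> exists k : int, z = w + k * M%:Z.
Proof.
move=> E; have [k kE] := column_of_nat z; have [l lE] := column_of_nat w.
by exists (l - k); move: kE; rewrite E lE => /eqP h; rewrite mulrBl; lia.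
Qed.

Definition signed_drawing : {ptws vertex (prism m) -> R} -> S :=
  drawing (fun s (c : column) t => rail_curve s (c%:R + t))
          (fun (c : column) t => rung_curve c%:Z t).

Let rail_next s (c : column) : rail_curve s (c%:R + 1) = rail_curve s ((c +
  1)%R%:R + 0).
Proof.
rewrite val_column1 addr0; have [->|_] := eqVneq; last by rewrite natr1.
rewrite val_columnN1 natr1 -(rail_curve_period s 0 1).
by congr rail_curve; rewrite mul1r add0r.
Qed.

Let rung_ends (c : column) (s : bool) :
  rung_curve c%:Z s%:R = rail_curve s (c%:R + 0).
Proof. by rewrite rung_curve_end addr0. Qed.

Let rail_cont s (c : column) : continuous (fun t : R => rail_curve s (c%:R +
  t)).
Proof.
apply: comp_cont (@rail_curve_cont s); apply: add_cont; first exact: cst_cont.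
by move=> x; exact: cvg_id.
Qed.

Lemma signed_drawing_rail z s t : 0 <= t <= 1 ->
  signed_drawing (edge_point (G :=
    prism m) (column_of z, s) (column_of (z + 1), s) t) =
  rail_curve s (z%:~R + t).
Proof.
move=> t01; rewrite column_ofD1 /signed_drawing drawing_rail //.
have [k kE] := column_of_nat z.
rewrite -[(column_of z : nat)%:R]/((column_of z : nat)%:Z%:~R) kE intrD intrM.
by rewrite addrAC; exact: rail_curve_period.
Qed.

Lemma signed_drawing_rung z t : 0 <= t <= 1 ->
  signed_drawing (edge_point (G :=
    prism m) (column_of z, false) (column_of z, true) t) =
  rung_curve z t.
Proof.
move=> t01; rewrite /signed_drawing drawing_rung //.
by have [k kE] := column_of_nat z; rewrite kE rung_curve_period.
Qed.

(** Equality would make [1/2 - a y / 4] an integer, but [`|a y| <= 1]. *)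
Lemma rails_disjoint x y : rail_curve false x <> rail_curve true y.
Proof.
move=> /(cover_eq cov)[k [n [E1 E2]]].
have := interp_period k x; rewrite -E1 /= => ay.
have := interp_bound sg1 y; move: E2; rewrite /= mulrA -ay.
by case: (int_trichotomy n) => [->|[|]]; lra.
Qed.

Lemma rail_rung_disjoint s x z t : 0 < t < 1 -> rail_curve s x <> rung_curve z
  t.
Proof.
move=> t01 /(cover_eq cov)[k [n [E1 E2]]].
have := interp_period k x; rewrite -E1 /= interp_int // => az.
move: E2; rewrite /rung_height /rail_height; case: s; last first.
  rewrite mulrA -az; case: (sg1 z) => -> ;
    case: (int_trichotomy n) => [->|[|]]; lra.
rewrite mulrBr mulrA -az; case: (sg1 z) => ->; case: (sign_exprz k e1) => ->;
  case: (int_trichotomy n) => [->|[|]]; lra.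
Qed.

Lemma rail_curve_eq s x y : rail_curve s x = rail_curve s y ->
  exists k : int, y = x + k%:~R * M%:R.
Proof. by move=> /(cover_eq cov)[k [n [-> _]]]; exists k. Qed.

Lemma rung_curve_eq z w t u : 0 <= t <= 1 -> 0 <= u <= 1 ->
  rung_curve z t = rung_curve w u ->
  t = u /\ exists k : int, w = z + k * M%:Z.
Proof.
move=> t01 u01 /(cover_eq cov)[k [n [/= E1 E2]]].
have wE : w = z + k * M%:Z.
  by apply: (@intr_inj R); rewrite E1 intrD intrM.
split; last by exists k.
move: E2; rewrite /rung_height wE sg_shift mulrA.
rewrite -sg_shift -wE.
by case: (sg1 w) => ->; case: (int_trichotomy n) => [->|[|]]; lra.
Qed.

Lemma column_shift0 (c d : column) (t u : R) (k : int) :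
  0 <= t < 1 -> 0 <= u < 1 -> d%:R + u = c%:R + t + k%:~R * M%:R ->
  k = 0 /\ c = d /\ t = u.
Proof.
move=> t01 u01 E.
have bd (f : column) : 0 <= (f%:R : R) <= M%:R - 1.
  by rewrite ler0n lerBrDr natr1 ler_nat ltn_ord.
have M0 : 0 < M%:R :> R by rewrite ltr0n.
have k0 : k = 0.
  have bc := bd c; have bd' := bd d; case: (int_trichotomy k) => [//|h].
  case: h => h; exfalso.
    by have /= := ler_wpM2r (ltW M0) h; lra.
  by have /= := ler_wpM2r (ltW M0) h; lra.
split=> //; move: E; rewrite k0 mul0r addr0 => E.
suff cd : c = d by split => //; move: E; rewrite cd; lra.
apply: val_inj => /=; have [h|h|//] := ltngtP (c : nat) (d : nat);
  by exfalso; move: h; rewrite -(ler_nat R) -natr1; lra.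
Qed.

Lemma signed_drawing_embedding : is_embedding signed_drawing.
Proof.
apply: drawing_embedding => //; first by move=> c; exact: rung_curve_cont.
move=> [s c t|c t] [r d u|d u] /= t01 u01.
- case: s r => [] [] E; last 2 first.
  + by case: (rails_disjoint E).
  + have [k kE] := rail_curve_eq E.
    by have [_ [-> ->]] := column_shift0 t01 u01 kE.
  + have [k kE] := rail_curve_eq E.
    by have [_ [-> ->]] := column_shift0 t01 u01 kE.
  + by case: (rails_disjoint (esym E)).
- by move/(rail_rung_disjoint u01).
- by move/esym/(rail_rung_disjoint t01).
- have t01' : 0 <= t <= 1 by lra.
  have u01' : 0 <= u <= 1 by lra.
  case/(rung_curve_eq t01' u01') => -> [k kE]; congr OnRung.
  have z01 : 0 <= (0 : R) < 1 by rewrite lexx ltr01.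
  have [|_ [->]//] := @column_shift0 c d 0 0 k z01 z01.
  rewrite !addr0; have := congr1 (intr : int -> R) kE.
  by rewrite intrD intrM.
Qed.

(** * Faces of the drawing and the partition of the surface *)

(** [c] and [d] are consecutive columns of the same sign; the bound on [d] keeps
the columns from [c] to [d] distinct modulo [M], so that the boundary walk of
the face is a cycle. *)
Definition face (c d : int) : Prop :=
  [/\ c < d, d < c + M%:Z, sg c = sg d &
      forall z, c < z -> z < d -> sg z <> sg c].

Lemma deck_sign_neq0 (k : int) : e ^ k != 0.
Proof. by case: (sign_exprz k e1) => ->; rewrite ?oppr_eq0 oner_eq0. Qed.

Lemma face_shift (k c d : int) : face c d -> face (c + k * M%:Z) (d + k * M%:Z).
Proof.
case=> cd dM E btw; split; [lia | lia | by rewrite !sg_shift E |].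
move=> z z1 z2; rewrite -(subrK (k * M%:Z) z) !sg_shift => /(mulfI
  (deck_sign_neq0 k)).
by apply: btw; lia.
Qed.

(** The open band of sign [s] lies between the two rails; it contains the point of
ordinate [s / 4]. Over each abscissa its height is at most [3/4], and the bands
of opposite signs do not overlap modulo 1. *)
Definition in_band (s x y : R) : bool :=
  (s * (a x / 8) < s * y) && (s * y < 2^-1 - s * (a x / 8)).

Lemma band_disjoint (s r x y : R) (n : int) : s = 1 \/ s = -1 -> r = 1 \/ r =
  -1 ->
  in_band s x y -> in_band r x (y + n%:~R) -> s = r /\ n = 0.
Proof.
move=> s1 r1; rewrite /in_band; have := interp_bound sg1 x.
by case: (int_trichotomy n) => [->|[|]]; case: s1 => ->; case: r1 => ->;
  (split=> //; exfalso; lra) || (split=> //; lra).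
Qed.

Lemma band_rail (s x y : R) (b : bool) (n : int) : s = 1 \/ s = -1 ->
  in_band s x y -> y <> rail_height b x + n%:~R.
Proof.
move=> s1; rewrite /in_band /rail_height => h; have := interp_bound sg1 x.
by move: h; case: (int_trichotomy n) => [->|[|]]; case: s1 => ->; case: b; lra.
Qed.

Lemma band_rung (s y t : R) (z : int) (n : int) : s = 1 \/ s = -1 -> 0 < t < 1
  ->
  in_band s z%:~R y -> y = rung_height z t + n%:~R -> s = sg z.
Proof.
move=> s1 t01; rewrite /in_band /rung_height interp_int //.
case: (sg1 z) => ->; case: s1 => -> //; case: (int_trichotomy n) => [->|[|]];
  by move=> *; exfalso; lra.
Qed.

Lemma band_cover (x y : R) : exists n : int,
  (exists b, y = rail_height b x + n%:~R) \/
  (exists2 s : R, s = 1 \/ s = -1 & in_band s x (y + n%:~R)).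
Proof.
have bd := interp_bound sg1 x.
have /andP[] := floor_itv (y - a x / 8); set f := Num.floor _;
  rewrite intrD => f0 f1.
have [h|h|h] := ltgtP (y - f%:~R) (a x / 8); first by exfalso; lra.
  have [h'|h'|h'] := ltgtP (y - f%:~R) (2^-1 - a x / 8).
  - exists (- f); right; exists 1; first by left.
    by rewrite /in_band intrN; lra.
  - exists (- f - 1); right; exists (-1); first by right.
    by rewrite /in_band intrD !intrN; lra.
  - by exists f; left; exists true; rewrite /rail_height; lra.
by exists f; left; exists false; rewrite /rail_height; lra.
Qed.

Definition region (c d : int) : set (R * R) :=
  [set q | [/\ c%:~R < q.1, q.1 < d%:~R & in_band (sg c) q.1 q.2]].

Definition cell (c d : int) : set S := p @` region c d.

Lemma in_band_shift (k : int) (s x y : R) : in_band (e ^ k * s) (x + k%:~R *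
  M%:R) (e ^ k * y) =
  in_band s x y.
Proof.
rewrite /in_band interp_period.
have kk : e ^ k * e ^ k = 1 by case: (sign_exprz k e1) => ->; ring.
have -> : e ^ k * s * (e ^ k * a x / 8) = (e ^ k * e ^ k) * (s * (a x / 8)) by
  ring.
have -> : e ^ k * s * (e ^ k * y) = (e ^ k * e ^ k) * (s * y) by ring.
by rewrite kk !mul1r.
Qed.

Lemma region_shift (k : int) c d q : region c d q ->
  region (c + k * M%:Z) (d + k * M%:Z) (q.1 + k%:~R * M%:R, e ^ k * q.2).
Proof.
by case=> h1 h2 h3; split;
  rewrite ?intrD ?intrM /= ?ltrD2r // sg_shift in_band_shift.
Qed.

Lemma cell_shift (k : int) c d : cell (c + k * M%:Z) (d + k * M%:Z) = cell c d.
Proof.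
have sub l u v : cell u v `<=` cell (u + l * M%:Z) (v + l * M%:Z).
  move=> _ [q qr <-]; exists (q.1 + l%:~R * M%:R, e ^ l * q.2).
    exact: region_shift.
  by apply/esym/(cover_eq cov); exists l, 0; rewrite addr0.
rewrite eqEsubset; split; last exact: sub.
by have := sub (- k) (c + k * M%:Z) (d + k * M%:Z); rewrite mulNr !addrK.
Qed.

(** After translating the first region by the deck transformation, both points lie
over the same abscissa. The bands then agree, with no vertical shift, and two
intervals of consecutive columns of equal sign that overlap coincide. *)
Lemma region_overlap c d c' d' q q' : face c d -> face c' d' ->
  region c d q -> region c' d' q' -> p q = p q' ->
  exists k : int, [/\ c' = c + k * M%:Z, d' = d + k * M%:Z &
    q' = (q.1 + k%:~R * M%:R, e ^ k * q.2)].
Proof.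
move=> fcd fcd' qr [x1' x2' b'] /(cover_eq cov)[k [n qE]].
have := face_shift k fcd; have := region_shift k qr.
rewrite qE /= in x1' x2' b' *.
set c1 := c + _; set d1 := d + _; move=> [/= x1 x2 b] f1.
have [E n0] := band_disjoint (sg1 _) (sg1 _) b b'.
move: f1 fcd' => [cd1 _ E1 btw1] [cd' _ E' btw'].
have lt1 : c1 < d' by rewrite -(ltr_int R); lra.
have lt2 : c' < d1 by rewrite -(ltr_int R); lra.
have cE : c' = c1.
  have [h|h|//] := ltgtP c' c1; first by case: (btw' _ h lt1).
  by case: (btw1 _ h lt2).
exists k; split => //; last by rewrite n0 addr0.
have [h|h|//] := ltgtP d' d1.
  by case: (btw1 d'); rewrite -?cE.
by case: (btw' d1); rewrite ?cE -?E1.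
Qed.

Lemma cell_overlap c d c' d' : face c d -> face c' d' ->
  cell c d `&` cell c' d' !=set0 -> cell c d = cell c' d'.
Proof.
move=> f f' [_ [[q qr <-] [q' qr' /esym qq']]].
have [k [-> -> _]] := region_overlap f f' qr qr' qq'.
by rewrite cell_shift.
Qed.

Lemma region_proj_inj c d : face c d -> {in region c d &, injective p}.
Proof.
move=> f q q'; rewrite !inE => qr qr' E.
have [k [ck _ ->]] := region_overlap f f qr qr' E.
have k0 : k = 0 by have M0 : (0 : int) < M%:Z by []; nia.
by rewrite k0 mul0r addr0 expr0z mul1r; case: (q).
Qed.

Local Notation drawn := (signed_drawing @` @realization R (prism m)).

Lemma drawn_rail s x : drawn (rail_curve s x).
Proof.
have /andP[f0 f1] := floor_itv x; set z := Num.floor x in f0 f1.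
rewrite intrD in f1.
have t01 : 0 <= x - z%:~R <= 1 by lra.
exists (edge_point (G :=
  prism m) (column_of z, s) (column_of (z + 1), s) (x - z%:~R)).
  exists (column_of z, s), (column_of (z + 1), s), (x - z%:~R); split => //.
  by right; rewrite column_ofD1; exact: edge_rail.
by rewrite signed_drawing_rail // addrC subrK.
Qed.

Lemma drawn_rung z t : 0 <= t <= 1 -> drawn (rung_curve z t).
Proof.
move=> t01.
exists (edge_point (G := prism m) (column_of z, false) (column_of z, true) t).
  exists (column_of z, false), (column_of z, true), t; split => //.
  by right; exact: edge_rung.
exact: signed_drawing_rung.
Qed.

Lemma drawnP y : drawn y -> (exists s x, y = rail_curve s x) \/
  (exists z t, 0 < t < 1 /\ y = rung_curve z t).
Proof.
rewrite /signed_drawing drawing_image // => -[[s c t|c t] /= t01 ->].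
  by left; exists s, (c%:R + t).
by right; exists c%:Z, t.
Qed.

Lemma vertical_fiber q y : p q = p (q.1, y) -> exists n : int, q.2 = y + n%:~R.
Proof.
move=> /(cover_eq cov)[k [n]] /pair_equal_spec[/= E1 E2].
have k0 : k = 0.
  have kM : k%:~R * M%:R = 0 :> R by lra.
  move/eqP: kM; rewrite mulf_eq0 intr_eq0 => /orP[/eqP//|].
  by rewrite pnatr_eq0.
by exists (- n); rewrite E2 k0 expr0z mul1r intrN addrK.
Qed.

Lemma cell_drawn c d : face c d -> cell c d `&` drawn = set0.
Proof.
move=> [cd dM E btw]; rewrite predeqE => y; split => // -[[q [q1 q2 qb] qy]].
rewrite -{}qy => /drawnP[[s [x qE]]|[z [t [t01 qE]]]]; have := qE;
  move=> /esym/(cover_eq cov)[k [n /(congr1 fst) /= E1]].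
  move: qE; rewrite -(rail_curve_period s x k) -E1 => /vertical_fiber[l lE].
  exact: (band_rail (sg1 c) qb lE).
have zE : q.1 = (z + k * M%:Z)%:~R by rewrite intrD intrM.
move: qE; rewrite -(rung_curve_period z t k) /rung_curve -zE.
move=> /vertical_fiber[l lE]; rewrite zE in qb q1 q2.
have := band_rung (sg1 c) t01 qb lE; apply/nesym; apply: btw.
  by rewrite -(ltr_int R).
by rewrite -(ltr_int R).
Qed.

Hypothesis faceP : forall c, exists d, face c d.
Hypothesis signP : forall (z : int) (s : R), s = 1 \/ s = -1 ->
  exists i : nat, sg (z - i%:Z) = s.

Lemma previous_column (z : int) (s : R) : s = 1 \/ s = -1 ->
  exists c, [/\ c <= z, sg c = s & forall w, c < w -> w <= z -> sg w <> s].
Proof.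
move=> s1; have ex : exists i : nat, sg (z - i%:Z) == s.
  by have [i /eqP iE] := signP z s1; exists i.
case: (ex_minnP ex) => i /eqP iE imin; exists (z - i%:Z); split => //;
  first by lia.
move=> w w1 w2 wE; have := imin `|z - w|%N.
rewrite gez0_abs; last by lia.
rewrite (_ : z - (z - w) = w); last by ring.
by rewrite wE eqxx => /(_ isT); lia.
Qed.

(** Off the rails, a point lies in the band of some sign [s]; the last column of
sign [s] on its left either supports it, and then it is on a rung, or starts the
face that contains it. *)
Lemma cell_cover y : drawn y \/ exists c d, face c d /\ cell c d y.
Proof.
have [q <-] := cover_surj cov y.
have [n [[b bE]|[s s1 qb]]] := band_cover q.1 q.2.
  left; rewrite (_ : p q = rail_curve b q.1); first exact: drawn_rail.
  by apply/esym/(cover_eq cov); exists 0, n;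
    rewrite mul0r addr0 expr0z mul1r -bE; case: (q).
have -> : p q = p (q.1, q.2 + n%:~R).
  by apply/(cover_eq cov); exists 0, n; rewrite mul0r addr0 expr0z mul1r.
move: (q.1) (q.2 + n%:~R) qb => x z qb {q n}.
have /andP[f0 f1] := floor_itv x; set f := Num.floor x in f0 f1.
have [c [cf cs btw]] := previous_column f s1.
have [d fcd] := faceP c; have [cd dM E btw'] := fcd.
have fd : f < d.
  by rewrite ltNge; apply/negP => df; apply: (btw d) => //; rewrite -E.
have xd : x < d%:~R.
  by apply: lt_le_trans f1 _; rewrite ler_int; lia.
have cx : c%:~R <= x by apply: le_trans f0; rewrite ler_int.
move: cx; rewrite le_eqVlt => /orP[/eqP cx|cx]; last first.
  by right; exists c, d; split => //; exists (x, z) => //; split;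
    rewrite //= cs.
left; rewrite -{}cx in qb *; move: qb; rewrite /in_band interp_int // cs.
have ss : s * s = 1 by case: s1 => ->; ring.
have -> : s * (s / 8) = 8^-1 by rewrite mulrA ss mul1r.
move=> qb; have -> : p (c%:~R, z) = rung_curve c (4 * (s * z - 8^-1)).
  rewrite /rung_curve /rung_height cs; congr (p (_, _)).
  rewrite (_ : _ * _ = (s * s) * z); last by field.
  by rewrite ss mul1r.
by apply: drawn_rung; lra.
Qed.

Lemma drawn_compl : ~` drawn =
  \bigcup_(x : {cd : int * int | face cd.1 cd.2}) cell (sval x).1 (sval x).2.
Proof.
rewrite predeqE => y; split => [ny|[[[c d] /= f] _ cy] dy].
  by have [//|[c [d [f cy]]]] := cell_cover y; exists (exist _ (c, d) f).
have : (cell c d `&` drawn) y by split.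
by rewrite cell_drawn.
Qed.

(** * Charts and boundary walks of the faces *)

Section Chart.
Variables c d : int.
Hypothesis fcd : face c d.
Local Notation len := (d%:~R - c%:~R : R).

Let len_gt0 : 0 < len.
Proof. by case: fcd => cd _ _ _; rewrite subr_gt0 ltr_int. Qed.

Let sgc2 : sg c * sg c = 1.
Proof. by case: (sg1 c) => ->; ring. Qed.

(** The part of the band over [x] is the segment centred at [sg c / 4] with this
half-length. *)
Definition half_height (x : R) : R := 4^-1 - sg c * (a x / 8).

Lemma half_height_gt0 x : 0 < half_height x.
Proof.
have := interp_bound sg1 x; rewrite /half_height; case: (sg1 c) => ->; lra.
Qed.

Lemma half_height_cont (T : topologicalType) (f : T -> R) : continuous f ->
  continuous (fun x => half_height (f x)).
Proof.
move=> cf; apply: add_cont; first exact: cst_cont.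
apply: opp_cont; apply: mul_cont; first exact: cst_cont.
apply: mul_cont; last exact: cst_cont.
by apply: comp_cont cf _; exact: interp_cont.
Qed.

Definition chart_x (x : R) : R := c%:~R + len * ((x + 1) / 2).
(** The abscissa is rescaled by a constant and, over each abscissa, the ordinate by
a positive continuous factor, so that this is a homeomorphism of the whole
plane; it takes the open square to the lift of the face. *)
Definition chart (q : R * R) : R * R :=
  (chart_x q.1, sg c * (4^-1 + half_height (chart_x q.1) * q.2)).
Definition unchart (q : R * R) : R * R :=
  ((q.1 - c%:~R) / len * 2 - 1, (sg c * q.2 - 4^-1) / half_height q.1).

Lemma chartK : cancel chart unchart.
Proof.
move=> [x y]; rewrite /chart /unchart /=.
have l0 : len != 0 by rewrite gt_eqF.
have h0 : half_height (chart_x x) != 0 by rewrite gt_eqF // half_height_gt0.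
rewrite mulrA sgc2; congr pair; first by rewrite /chart_x; field.
by field.
Qed.

Lemma unchartK : cancel unchart chart.
Proof.
move=> [x y]; rewrite /chart /unchart /=.
have l0 : len != 0 by rewrite gt_eqF.
have xE : chart_x ((x - c%:~R) / len * 2 - 1) = x by rewrite /chart_x; field.
have h0 : half_height x != 0 by rewrite gt_eqF // half_height_gt0.
rewrite xE [half_height x * _]mulrC divfK //; congr pair.
rewrite (_ : _ * _ = (sg c * sg c) * y); last by ring.
by rewrite sgc2 mul1r.
Qed.

Lemma chart_cont : continuous chart.
Proof.
have cx : continuous (fun q : R * R => chart_x q.1).
  apply: add_cont; first exact: cst_cont.
  apply: mul_cont; first exact: cst_cont.
  apply: mul_cont; last exact: cst_cont.
  by apply: add_cont; [exact: fst_cont | exact: cst_cont].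
apply: pair_cont => //; apply: mul_cont; first exact: cst_cont.
apply: add_cont; first exact: cst_cont.
by apply: mul_cont; [exact: half_height_cont | exact: snd_cont].
Qed.

Lemma unchart_cont : continuous unchart.
Proof.
apply: pair_cont.
  apply: add_cont; last exact: cst_cont.
  apply: mul_cont; last exact: cst_cont.
  apply: mul_cont; last exact: cst_cont.
  by apply: add_cont; [exact: fst_cont | exact: cst_cont].
apply: mul_cont.
  apply: add_cont; last exact: cst_cont.
  by apply: mul_cont; [exact: cst_cont | exact: snd_cont].
apply: inv_cont => [q|]; first by rewrite gt_eqF // half_height_gt0.
by apply: half_height_cont; exact: fst_cont.
Qed.

Lemma region_chart q : region c d (chart q) <-> norm_sup q < 1.
Proof.
have l0 := len_gt0; have h0 := half_height_gt0 (chart_x q.1).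
rewrite /norm_sup gt_max !ltr_norml.
have -> : region c d (chart q) <->
    [/\ c%:~R < chart_x q.1,
      chart_x q.1 < d%:~R & in_band (sg c) (chart_x q.1) (chart q).2].
  by [].
have -> : in_band (sg c) (chart_x q.1) (chart q).2 =
    (sg c * (a (chart_x q.1) / 8) < 4^-1 + half_height (chart_x q.1) * q.2) &&
    (4^-1 + half_height (chart_x q.1) * q.2 < 2^-1 - sg c * (a (chart_x q.1) /
      8)).
  suff sy : sg c * (chart q).2 = 4^-1 + half_height (chart_x q.1) * q.2.
    by rewrite /in_band sy.
  by rewrite /chart /= mulrA sgc2 mul1r.
have E : sg c * (a (chart_x q.1) / 8) = 4^-1 - half_height (chart_x q.1).
  by rewrite /half_height; ring.
rewrite E; set h := half_height _ in h0 *.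
have x1 : (c%:~R < chart_x q.1) = (-1 < q.1).
  rewrite -subr_gt0 /chart_x addrC addKr pmulr_rgt0 //; apply/idP/idP; lra.
have x2 : (chart_x q.1 < d%:~R) = (q.1 < 1).
  rewrite -subr_gt0 (_ : _ - _ = len * ((1 - q.1) / 2)); last first.
    by rewrite /chart_x; field.
  by rewrite pmulr_rgt0 //; apply/idP/idP; lra.
have y1 : (4^-1 - h < 4^-1 + h * q.2) = (-1 < q.2).
  rewrite -subr_gt0 (_ : _ - _ = h * (q.2 + 1)); last by ring.
  by rewrite pmulr_rgt0 //; apply/idP/idP; lra.
have y2 : (4^-1 + h * q.2 < 2^-1 - (4^-1 - h)) = (q.2 < 1).
  rewrite -subr_gt0 (_ : _ - _ = h * (1 - q.2)); last by field.
  by rewrite pmulr_rgt0 //; apply/idP/idP; lra.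
rewrite x1 x2 y1 y2; split => [[-> -> /andP[-> ->]]//|].
by case/andP => /andP[-> ->] /andP[-> ->].
Qed.

Definition disc_chart (q : R * R) : R * R := chart (square_of_disc q).

Lemma disc_chart_cont : continuous disc_chart.
Proof. exact: comp_cont (@square_of_disc_cont R) chart_cont. Qed.

Lemma disc_chart_inj : injective disc_chart.
Proof. exact: inj_comp (can_inj chartK) (can_inj (@square_of_discK R)). Qed.

Lemma disc_chart_open (U : set (R * R)) : open U -> open (disc_chart @` U).
Proof.
move=> oU; rewrite (_ : _ @` U = (fun q => disc_of_square (unchart q)) @^-1` U).
  apply: open_comp => // q _.
  exact: (comp_cont unchart_cont (@disc_of_square_cont R)).
rewrite predeqE => q; split => [[x Ux <-]|Uq].
  by rewrite /disc_chart /= chartK square_of_discK.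
exists (disc_of_square (unchart q)) => //.
by rewrite /disc_chart disc_of_squareK unchartK.
Qed.

Lemma disc_chart_image : disc_chart @` @open_disc R = region c d.
Proof.
rewrite open_discE predeqE => q; split => [[x x1 <-]|qr].
  by apply/region_chart; rewrite norm_sup_square_of_disc.
exists (disc_of_square (unchart q)).
  by rewrite /= norm2_disc_of_square; apply/region_chart; rewrite unchartK.
by rewrite /disc_chart disc_of_squareK unchartK.
Qed.

Definition face_map (q : R * R) : S := p (disc_chart q).

Lemma face_map_cont : continuous face_map.
Proof. exact: comp_cont disc_chart_cont (cover_cont cov). Qed.

Lemma face_map_image : face_map @` @open_disc R = cell c d.
Proof. by rewrite /cell -disc_chart_image -image_comp. Qed.

Lemma face_map_inj : {in @open_disc R &, injective face_map}.
Proof.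
move=> x y; rewrite !inE => xO yO /(region_proj_inj fcd) E.
apply: disc_chart_inj; apply: E; rewrite inE -disc_chart_image.
  by exists x.
by exists y.
Qed.

Lemma face_map_open (U : set (R * R)) : open U -> open (face_map @` U).
Proof.
move=> oU; rewrite /face_map -(image_comp disc_chart p).
by apply: (cover_open cov); exact: disc_chart_open.
Qed.

Lemma cell_open : open (cell c d).
Proof. by rewrite -face_map_image; apply: face_map_open;
  exact: open_disc_open. Qed.

Lemma cell_connected : connected (cell c d).
Proof.
rewrite -face_map_image; apply: connected_continuous_connected.
  exact: open_disc_connected.
by apply: continuous_subspaceT; exact: face_map_cont.
Qed.

Lemma cell_homeomorphic : homeomorphic (@open_disc R) (cell c d).
Proof.
rewrite -face_map_image; apply: homeomorphic_image.
- by apply: continuous_subspaceT; exact: face_map_cont.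
- exact: face_map_inj.
- by move=> U oU _; exact: face_map_open.
- exact: open_disc_open.
- by exists 0; rewrite open_discE /= (eqP (_ : norm2 0 == 0)) ?norm2_eq0.
Qed.

Local Notation j := `|d - c|%N.
Local Notation k := (2 * j).+2.

Let jE : j%:Z = d - c.
Proof. by case: fcd => cd _ _ _; rewrite gez0_abs; lia. Qed.

Let jR : j%:R = len.
Proof. by rewrite -[j%:R]/(j%:Z%:~R) jE intrD intrN. Qed.

Definition face_walk (i : 'I_k) : vertex (prism m) :=
  if (i <= j)%N then (column_of (c + i%:Z), false)
  else (column_of (c + (2 * j).+1%:Z - i%:Z), true).

Lemma face_walk_steps (i : 'I_k) :
  [\/ [/\ (i < j)%N, face_walk i = (column_of (c + i%:Z), false) &
         face_walk (ordS i) = (column_of (c + i%:Z + 1), false)],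
      [/\ i = j :> nat, face_walk i = (column_of d, false) &
         face_walk (ordS i) = (column_of d, true)],
      exists2 z, z = c + (2 * j)%N%:Z - i%:Z &
        [/\ (j < i < (2 * j).+1)%N, face_walk i = (column_of (z + 1), true) &
          face_walk (ordS i) = (column_of z, true)] |
      [/\ i = (2 * j).+1 :> nat, face_walk i = (column_of c, true) &
         face_walk (ordS i) = (column_of c, false)]].
Proof.
have jz := jE; have ik := ltn_ord i; rewrite /face_walk /=.
have [ik'|ik'] := eqVneq (i : nat) (2 * j).+1.
  apply: Or44; split => //; first by rewrite ik' ifF ?addrK //; lia.
  by rewrite ik' modnn addr0.
rewrite modn_small; last by lia.
have [ij|ij] := ltnP i j.
  apply: Or41; split => //; first by rewrite ifT //; lia.
  by rewrite -addrA; congr (column_of _, _); lia.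
have [ij'|ij'] := eqVneq (i : nat) j.
  apply: Or42; split => //.
    by rewrite ij' leqnn; congr (column_of _, _); lia.
  by rewrite ij'; congr (column_of _, _); lia.
apply: Or43; exists (c + (2 * j)%N%:Z - i%:Z) => //; split; first by lia.
  by rewrite ifF; [congr (column_of _, _) | ]; lia.
by congr (column_of _, _); lia.
Qed.

Lemma face_walk_cycle : is_cycle face_walk.
Proof.
have jz := jE; have [cd dM _ _] := fcd.
split; [split => // i | lia |].
  have [[_ -> ->]|[_ -> ->]|[z _ [_ -> ->]]|[_ -> ->]] := face_walk_steps i.
  - by rewrite column_ofD1; exact: edge_rail.
  - exact: edge_rung.
  - by rewrite edge_sym column_ofD1; exact: edge_rail.
  - exact: edge_rung.
have cM i i' : (i <= j)%N -> (i' <= j)%N ->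
    column_of (c + i%:Z) = column_of (c + i'%:Z) -> i = i'.
  move=> ij ij' /column_of_eq[l lE]; have M0 : (0 : int) < M%:Z by [].
  have l0 : l = 0 by nia.
  by move: lE; rewrite l0; lia.
move=> i i' E; apply: val_inj => /=.
have ik := ltn_ord i; have ik' := ltn_ord i'; move: E.
rewrite /face_walk; case: ifP => ij; case: ifP => ij' // [].
  exact: cM.
have -> : c + (2 * j).+1%:Z - i%:Z = c + ((2 * j).+1 - i)%N%:Z by lia.
have -> : c + (2 * j).+1%:Z - i'%:Z = c + ((2 * j).+1 - i')%N%:Z by lia.
by move/cM => h; have := h _ _; lia.
Qed.

Lemma signed_drawing_rail_rev z s t : 0 <= t <= 1 ->
  signed_drawing (edge_point (G :=
    prism m) (column_of (z + 1), s) (column_of z, s) t) =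
  rail_curve s (z%:~R + 1 - t).
Proof.
by move=> t01; rewrite edge_point_sym signed_drawing_rail ?addrA //; lra.
Qed.

Lemma signed_drawing_rung_rev z t : 0 <= t <= 1 ->
  signed_drawing (edge_point (G :=
    prism m) (column_of z, true) (column_of z, false) t) =
  rung_curve z (1 - t).
Proof.
by move=> t01; rewrite edge_point_sym signed_drawing_rung //; lra.
Qed.

Lemma chart_bottom x : p (chart (x, -1)) = rail_curve false (chart_x x).
Proof.
rewrite /rail_curve /rail_height /chart /=; congr (p (_, _)).
rewrite /half_height (_ : _ * _ = sg c * sg c * (a (chart_x x) / 8));
  last by ring.
by rewrite sgc2 mul1r.
Qed.

Lemma chart_top x : p (chart (x, 1)) = rail_curve true (chart_x x).
Proof.
rewrite /rail_curve /rail_height /chart /=.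
have -> : sg c * (4^-1 + half_height (chart_x x) * 1) =
    sg c / 2 - sg c * sg c * (a (chart_x x) / 8) by rewrite /half_height; field.
rewrite sgc2 mul1r; apply/(cover_eq cov) => /=.
case: (sg1 c) => ->; [exists 0, 0 | exists 0, 1]; rewrite mul0r !addr0 expr0z;
  by congr pair; field.
Qed.

Lemma chart_right y : p (chart (1, y)) = rung_curve d ((y + 1) / 2).
Proof.
have [_ _ E _] := fcd.
have xE : chart_x 1 = d%:~R by rewrite /chart_x; field.
rewrite /rung_curve /rung_height /chart /= xE; congr (p (_, _)).
rewrite /half_height interp_int // -E mulrA sgc2.
by field.
Qed.

Lemma chart_left y : p (chart (-1, y)) = rung_curve c ((y + 1) / 2).
Proof.
have xE : chart_x (-1) = c%:~R by rewrite /chart_x; field.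
rewrite /rung_curve /rung_height /chart /= xE; congr (p (_, _)).
rewrite /half_height interp_int // mulrA sgc2.
by field.
Qed.

(** On the horizontal sides the chart is uniform in the abscissa, so running along
the square with time 1 for each edge follows the linear parameters of the edges
of the drawing. *)
Definition face_loop (x : R) : R * R :=
  disc_of_square (square_loop len (k%:R * x)).

Lemma face_walk_facial : facial_walk signed_drawing (cell c d) face_walk.
Proof.
have l0 := len_gt0; have kE : k%:R = 2 * len + 2 :> R.
  by rewrite -addn2 natrD natrM jR.
split; first by have [] := face_walk_cycle.
exists face_map, face_loop; split.
- by apply: continuous_subspaceT; exact: face_map_cont.
- exact: face_map_inj.
- exact: face_map_image.
- split.
  + apply: continuous_subspaceT; apply: comp_cont (@disc_of_square_cont R).
    apply: (@comp_cont _ _ _ (fun x : R => k%:R * x) (square_loop len));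
      last exact: square_loop_cont.
    by apply: mul_cont; [exact: cst_cont | move=> x; exact: cvg_id].
  + by rewrite /face_loop mulr0 mulr1 kE square_loop_end.
  + move=> x y; rewrite !in_itv /= => x01 y01.
    move=> /(can_inj (@disc_of_squareK R)).
    have k0 : 0 < k%:R :> R by rewrite ltr0n.
    move=> /(square_loop_inj l0) h; apply: (mulfI (lt0r_neq0 k0)); apply: h.
      by rewrite kE in k0 *; nra.
    by rewrite kE in k0 *; nra.
  + rewrite unit_circleE predeqE => q; split => [[x /= x01 <-]|/= q1].
      rewrite /face_loop norm2_disc_of_square.
      have [xE|x1] := eqVneq x 1.
        by rewrite xE mulr1 kE (square_loop_end l0) (square_loop_norm l0) //;
          lra.
      apply: (square_loop_norm l0); rewrite kE; move: x01; rewrite in_itv /=.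
      by move=> /andP[x0]; rewrite le_eqVlt (negbTE x1) /= => x1'; nra.
    have [|x x01 xE] := square_loop_surj l0 (q := square_of_disc q).
      by rewrite norm_sup_square_of_disc.
    exists (x / k%:R).
      rewrite /= in_itv /= kE divr_ge0 ?ler_pdivrMr ?mul1r; lra.
    by rewrite /face_loop mulrC divfK ?xE ?square_of_discK // kE;
      apply: lt0r_neq0; lra.
move=> i t t01; rewrite /face_map /disc_chart /face_loop mulrC divfK;
  last by rewrite pnatr_eq0.
rewrite disc_of_squareK.
have iR (n : nat) : (n <= i)%N -> n%:R <= i%:R :> R by rewrite ler_nat.
have iR' (n : nat) : (i < n)%N -> i%:R + 1 <= n%:R :> R by rewrite natr1
  ler_nat.
have len0 : len != 0 by rewrite gt_eqF.
have i0 : 0 <= i%:R :> R by rewrite ler0n.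
have frac01 (y : R) : 0 <= y <= len -> 0 <= y / len <= 1.
  by move=> /andP[y0 y1]; rewrite divr_ge0 ?(ltW l0) //= ler_pdivrMr // mul1r.
have [[ij -> ->]|[ij -> ->]|[z zE [/andP[ji ij] -> ->]]|[ij -> ->]] :=
  face_walk_steps i.
- rewrite signed_drawing_rail // (_ : i%:R + t = len * ((i%:R + t) / len));
  last by field.
  have := iR' _ ij; rewrite jR => i1.
  rewrite square_loop_bottom //; last by apply: frac01; lra.
  rewrite chart_bottom; congr rail_curve; rewrite intrD /chart_x.
  by rewrite -[i%:Z%:~R]/(i%:R); field.
- rewrite signed_drawing_rung // ij jR square_loop_right // chart_right.
  by congr rung_curve; field.
- have := iR _ ji; have := iR' _ ij; rewrite -!natr1 natrM jR => i1 i2.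
  rewrite signed_drawing_rail_rev //.
  rewrite (_ : i%:R + t = len + 1 + len * ((i%:R + t - len - 1) / len));
    last by field.
  rewrite square_loop_top //; last by apply: frac01; lra.
  rewrite chart_top; congr rail_curve; rewrite zE !intrD intrN /chart_x.
  rewrite -[i%:Z%:~R]/(i%:R) -[(_ * _)%N%:Z%:~R]/((2 * j)%N%:R) natrM jR.
  by field.
- rewrite signed_drawing_rung_rev // ij -natr1 natrM jR square_loop_left //
  chart_left.
  by congr rung_curve; field.
Qed.

End Chart.

(** * The drawing as a strong embedding and its face lengths *)

Lemma signed_drawing_cell C :
  is_cell signed_drawing C <-> exists c d, face c d /\ C = cell c d.
Proof.
have compE c d : face c d -> forall x, cell c d x ->
    connected_component (~` drawn) x = cell c d.
  move=> f x cx; apply: (component_of_partition drawn_compl _ _ _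
    (i := exist (fun cd : int * int => face cd.1 cd.2) (c, d) f)) => //.
  - by move=> [[c' d'] f']; exact: cell_open.
  - by move=> [[c' d'] f']; exact: cell_connected.
  - by move=> [[c1 d1] f1] [[c2 d2] f2]; exact: cell_overlap.
split=> [[x nx ->]|[c [d [f ->]]]].
  have [//|[c [d [f cx]]]] := cell_cover x.
  by exists c, d; split => //; exact: compE.
have [x cx] : cell c d !=set0.
  by rewrite -(face_map_image f); exists (face_map c d 0), 0;
    rewrite // open_discE /= (eqP (_ : norm2 0 == 0)) ?norm2_eq0.
exists x; last by rewrite (compE _ _ f).
move=> dx; have : (cell c d `&` drawn) x by split.
by rewrite cell_drawn.
Qed.

Lemma signed_drawing_strong : is_strong signed_drawing.
Proof.
split; [split; first exact: signed_drawing_embedding|] => C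
  /signed_drawing_cell[c [d [f ->]]].
  exact: cell_homeomorphic.
by exists _, (@face_walk c d); split;
  [exact: face_walk_facial | exact: face_walk_cycle].
Qed.

(** Any facial walk of the cell has the same edges as [face_walk], both being
determined by the closure of the cell. *)
Lemma signed_drawing_facial_cycle E : facial_cycles signed_drawing E ->
  exists c d, face c d /\ #|E| = (2 * `|d - c|).+2%N.
Proof.
move=> [C [k [w [/signed_drawing_cell[c [d [f ->]]] fw _ ->]]]]; exists c, d;
  split => //.
have [_ inj] := signed_drawing_embedding.
rewrite (facial_walk_edges (cover_hausdorff cov) inj (cell_drawn f) fw).
rewrite -(facial_walk_edges (cover_hausdorff cov) inj (cell_drawn f)
  (face_walk_facial f)).
exact: card_walk_edges (face_walk_cycle f).
Qed.

Lemma face_facial_cycle c d : face c d ->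
  exists2 E, facial_cycles signed_drawing E & #|E| = (2 * `|d - c|).+2%N.
Proof.
move=> f; exists (walk_edges (@face_walk c d)).
  exists (cell c d), _, (@face_walk c d); split => //.
  - by apply/signed_drawing_cell; exists c, d.
  - exact: face_walk_facial.
  - exact: face_walk_cycle.
exact: card_walk_edges (face_walk_cycle f).
Qed.

End SignedDrawing.

(** * Sign patterns with distinct face lengths *)

Lemma at_least_signed_drawings (R : realType) (m : nat) (S : topologicalType)
  (e : R)
    (p : R * R -> S) (N : nat) (sg : 'I_N -> int -> R) (J : 'I_N -> nat) :
  e = 1 \/ e = -1 -> plane_cover e m.+3%:R p ->
  (forall a z, sg a z = 1 \/ sg a z = -1) ->
  (forall a z, sg a (z + m.+3%:Z) = e * sg a z) ->
  (forall a c, exists d, face m (sg a) c d) ->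
  (forall a z (s : R), s = 1 \/ s = -1 -> exists i : nat,
    sg a (z - i%:Z) = s) ->
  (forall a, exists c d, face m (sg a) c d /\ `|d - c|%N = J a) ->
  (forall a b, a != b -> forall c d, face m (sg b) c d -> `|d - c|%N <> J a) ->
  at_least_strong_embeddings R (prism m) S N.
Proof.
move=> e1 cov sg1 sgM faceP signP J1 J2.
exists (fun a => @signed_drawing R m S p (sg a)); split => [a|a b ab iso].
  exact: signed_drawing_strong e1 cov (sg1 a) (sgM a) (faceP a) (signP a).
have [c [d [f fJ]]] := J1 a.
have [E bE cE] := face_facial_cycle e1 cov (sg1 a) (sgM a) (faceP a) (signP a)
  f.
have [E' bE' cE'] := isomorphic_cycle_length iso bE.
have [c' [d' [f' cE'']]] :=
  signed_drawing_facial_cycle e1 cov (sg1 b) (sgM b) (faceP b) (signP b) bE'.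
by apply: (J2 _ _ ab _ _ f'); rewrite -fJ; lia.
Qed.

Section Patterns.
Variables (R : realType) (m : nat) (flip : bool) (a : nat).
Local Notation M := m.+3.
Hypothesis aM : (a + 8 < M)%N.

(** One period has a single run of [a + 3] equal signs when the sequence is
periodic. When it changes sign after each period, a run of 2 signs preceded by
[a + 3] others is used instead: a single change of sign in each period
would leave a face too long for its boundary to be a cycle. *)
Definition base_pattern (r : int) : bool :=
  if flip then (a.+3%:Z <= r) && (r < a.+3%:Z + 2) else r < a.+3%:Z.

Definition pattern (z : int) : bool :=
  base_pattern (z %% M%:Z)%Z (+) (flip && odd (absz (z %/ M%:Z)%Z)).

Definition pattern_sign (z : int) : R := (-1) ^+ pattern z.

Lemma pattern_sign1 z : pattern_sign z = 1 \/ pattern_sign z = -1.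
Proof. by rewrite /pattern_sign; case: pattern; [right | left]. Qed.

Lemma pattern_sign_eq z w : pattern_sign z = pattern_sign w <-> pattern z =
  pattern w.
Proof.
rewrite /pattern_sign; split=> [|-> //].
by case: pattern; case: pattern => //; rewrite ?expr0 ?expr1 => ?; exfalso; lra.
Qed.

Lemma odd_absD1 (h : int) : odd (absz (h + 1)) = ~~ odd (absz h).
Proof.
case: h => [h|h]; first by rewrite -PoszD absz_nat addn1.
have -> : Negz h + 1 = - h%:Z by rewrite NegzE intS; ring.
by rewrite NegzE !abszN !absz_nat /= negbK.
Qed.

Lemma patternE (h r : int) : 0 <= r -> r < M%:Z ->
  pattern (h * M%:Z + r) = base_pattern r (+) (flip && odd (absz h)).
Proof.
move=> r0 rM; have M0 : M%:Z != 0 by [].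
rewrite /pattern divzMDl // modzMDl divz_small ?modz_small ?addr0 //.
  by rewrite r0.
by rewrite r0.
Qed.

Lemma pattern_period z : pattern (z + M%:Z) = pattern z (+) flip.
Proof.
rewrite (divz_eq z M%:Z); have M0 : (0 : int) < M%:Z by [].
have r0 := modz_ge0 z (lt0r_neq0 M0); have rM := ltz_pmod z M0.
rewrite addrAC -[X in _ + X + _]mul1r -mulrDl !patternE // odd_absD1.
by case: (flip); rewrite ?addbN ?addbF ?addbT.
Qed.

(** The signs of two consecutive periods, up to a common factor. *)
Definition two_periods (t : int) : bool :=
  if t < M%:Z then base_pattern t else base_pattern (t - M%:Z) (+) flip.

Lemma two_periodsE (h t : int) : 0 <= t -> t < 2 * M%:Z ->
  pattern (h * M%:Z + t) = two_periods t (+) (flip && odd (absz h)).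
Proof.
move=> t0 tM; rewrite /two_periods; case: ltP => tM'; first by rewrite patternE.
rewrite -{1}(subrK M%:Z t) addrA pattern_period patternE; [|lia|lia].
by rewrite -!addbA [flip (+) _]addbC.
Qed.

Lemma pattern_face (h r t : int) : 0 <= r -> r < M%:Z -> r < t -> t < r + M%:Z
  ->
  two_periods t = two_periods r ->
  (forall u, r < u -> u < t -> two_periods u != two_periods r) ->
  face m pattern_sign (h * M%:Z + r) (h * M%:Z + t).
Proof.
move=> r0 rM rt tM E btw; split; [lia | lia | |].
  by apply/pattern_sign_eq; rewrite !two_periodsE ?E //; lia.
move=> z z1 z2; rewrite (_ : z = h * M%:Z + (z - h * M%:Z)); last by ring.
move/pattern_sign_eq; rewrite !two_periodsE; try lia.
move/addIb => Eu; have := btw (z - h * M%:Z); rewrite Eu eqxx => bad.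
by suff : false by []; apply: bad; lia.
Qed.

(** Inside a run the next column of the same sign is adjacent; at the end of a run
it comes after the following run, whose length is [2], [a + 3] or what remains
of the period. *)
Definition jumps : seq nat := [:: 1; 3; a + 4; M - (a + 2); M - (a + 4)]%N.

Lemma in_jumps : [/\ 1%N \in jumps, 3%N \in jumps, (a + 4)%N \in jumps,
  (M - (a + 2))%N \in jumps & (M - (a + 4))%N \in jumps].
Proof. by split; rewrite !inE eqxx ?orbT. Qed.

Definition jump (r : int) (j : nat) : Prop :=
  [/\ (0 < j < M)%N, two_periods (r + j%:Z) = two_periods r &
     forall u, r < u -> u < r + j%:Z -> two_periods u != two_periods r].

Lemma two_periodsP (u : int) : two_periods u =
  if flip then
    ((a.+3%:Z <= u) && (u < a.+3%:Z + 2)) ||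
    ((M%:Z <= u) && (u < M%:Z + a.+3%:Z)) || (M%:Z + a.+3%:Z + 2 <= u)
  else (u < a.+3%:Z) || ((M%:Z <= u) && (u < M%:Z + a.+3%:Z)).
Proof.
have aM' := aM; rewrite /two_periods /base_pattern.
by case: (flip); rewrite ?addbF ?addbT; case: ltP => h; lia.
Qed.

Ltac decide_jump E := have aM' := aM;
  by split => [|| u u1 u2]; rewrite ?two_periodsP ?E; lia.

Lemma jump_ex (r : int) : 0 <= r -> r < M%:Z -> exists2 j,
  j \in jumps & jump r j.
Proof.
move=> r0 rM.
have [j1 j3 ja jb jc] := in_jumps.
have [E|E] : flip = true \/ flip = false by case: (flip); [left | right].
  have [c1|c1] := ltP r (a.+3%:Z - 1); first by exists 1%N => //; decide_jump E.
  have [c2|c2] := ltP r a.+3%:Z; first by exists 3%N => //; decide_jump E.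
  have [c3|c3] := ltP r (a.+3%:Z + 1); first by exists 1%N => //; decide_jump E.
  have [c4|c4] := ltP r (a.+3%:Z + 2).
    by exists (M - (a + 4))%N => //; decide_jump E.
  have [c5|c5] := ltP r (M%:Z - 1); first by exists 1%N => //; decide_jump E.
  by exists (a + 4)%N => //; decide_jump E.
have [c1|c1] := ltP r (a.+3%:Z - 1); first by exists 1%N => //; decide_jump E.
have [c2|c2] := ltP r a.+3%:Z.
  by exists (M - (a + 2))%N => //; decide_jump E.
have [c5|c5] := ltP r (M%:Z - 1); first by exists 1%N => //; decide_jump E.
by exists (a + 4)%N => //; decide_jump E.
Qed.

Lemma pattern_face_ex c : exists2 d,
  face m pattern_sign c d & `|d - c|%N \in jumps.
Proof.
have M0 : (0 : int) < M%:Z by [].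
have r0 := modz_ge0 c (lt0r_neq0 M0); have rM := ltz_pmod c M0.
rewrite (divz_eq c M%:Z); move: (c %/ _)%Z (c %% _)%Z r0 rM => h r r0 rM.
have [j jJ [j0 E btw]] := jump_ex r0 rM.
exists (h * M%:Z + (r + j%:Z)); first by apply: pattern_face => //; lia.
by rewrite (_ : `|_|%N = j) //; lia.
Qed.

Lemma jump_last : jump (M%:Z - 1) (a + 4).
Proof.
have [E|E] : flip = true \/ flip = false.
  by case: (flip); [left | right].
- decide_jump E.
- decide_jump E.
Qed.

Lemma face_fun c d d' : face m pattern_sign c d -> face m pattern_sign c d' ->
  d = d'.
Proof.
move=> [cd _ E btw] [cd' _ E' btw']; have [h|h|//] := ltgtP d d'.
  by case: (btw' d).
by case: (btw d').
Qed.

Lemma pattern_jumps c d : face m pattern_sign c d -> `|d - c|%N \in jumps.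
Proof. by have [d' f' jJ] := pattern_face_ex c; move=> /(face_fun f') <-. Qed.

Lemma pattern_face_last : exists c d,
  face m pattern_sign c d /\ `|d - c|%N = (a + 4)%N.
Proof.
have [j0 E btw] := jump_last.
exists (0 * M%:Z + (M%:Z - 1)), (0 * M%:Z + (M%:Z - 1 + (a + 4)%N%:Z)).
by split; [apply: pattern_face => //; lia | lia].
Qed.

Lemma pattern_both (z : int) (s : R) : s = 1 \/ s = -1 ->
  exists i : nat, pattern_sign (z - i%:Z) = s.
Proof.
move=> s1; have aM' := aM.
suff [w wz wE] : exists2 w, w <= z & pattern_sign w = s.
  exists `|z - w|%N; rewrite gez0_abs; last by lia.
  by rewrite (_ : z - (z - w) = w) //; ring.
have M0 : (0 : int) < M%:Z by [].
have r0 := modz_ge0 z (lt0r_neq0 M0); have zE := divz_eq z M%:Z.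
set h := (z %/ _)%Z in zE; pose w (r : int) := (h - 1) * M%:Z + r.
have wz r : r < M%:Z -> w r <= z by rewrite /w; nia.
have wP r : 0 <= r -> r < M%:Z ->
    pattern (w r) = base_pattern r (+) (flip && odd (absz (h - 1))).
  exact: patternE.
have [r [q [rM qM rq]]] : exists r q : int, [/\ 0 <= r /\ r < M%:Z,
    0 <= q /\ q < M%:Z & base_pattern r = ~~ base_pattern q].
  exists 0, a.+3%:Z; split; [by split|by split => //; lia|].
  by rewrite /base_pattern; case: (flip); lia.
have opp : pattern (w r) = ~~ pattern (w q).
  by rewrite !wP ?rq ?addNb; case: rM; case: qM.
have [E|E] : pattern_sign (w r) = s \/ pattern_sign (w q) = s.
  rewrite /pattern_sign opp.
  by case: (pattern _); case: s1 => ->; rewrite /= ?expr0 ?expr1;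
    [left|right|right|left].
- by exists (w r) => //; apply: wz; case: rM.
- by exists (w q) => //; apply: wz; case: qM.
Qed.

End Patterns.

(** The difference [k + 4] identifies the pattern of index [k]: in the pattern of
index [b] the differences are at most 3, equal to [b + 4], or larger than
[N + 4]. *)
Lemma pattern_embeddings (R : realType) (m N : nat) (flip : bool)
    (S : topologicalType) (p : R * R -> S) :
  (2 * N + 10 < m.+3)%N -> plane_cover ((-1) ^+ flip) m.+3%:R p ->
  at_least_strong_embeddings R (prism m) S N.
Proof.
move=> Nm cov; have aM (a : 'I_N) : (a + 8 < m.+3)%N by have := ltn_ord a; lia.
apply: (@at_least_signed_drawings R m S ((-1) ^+ flip) p N
  (fun a => pattern_sign R m flip a) (fun a => a + 4)%N) => //.
- by case: (flip); [right; rewrite expr1 | left].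
- by move=> a z; exact: pattern_sign1.
- by move=> a z; rewrite /pattern_sign pattern_period signr_addb mulrC.
- by move=> a c; have [d f _] := pattern_face_ex R flip (aM a) c; exists d.
- by move=> a z s s1; exact: pattern_both.
- by move=> a; exact: pattern_face_last.
- move=> a b ab c d /(pattern_jumps (aM b)); rewrite /jumps !inE => h E.
  have an := ltn_ord a; have bn := ltn_ord b.
  have {}ab : (a : nat) <> b by move=> /val_inj /eqP; rewrite (negbTE ab).
  by move: h; rewrite E; lia.
Qed.

Local Close Scope ring_scope.
Local Close Scope classical_set_scope.

Theorem theorem3p9 (R : realType) (n i : nat) (hn : (3 < n)%N)
    (hi : i = 0%N \/ i = 1%N) (hin : (i = n %[mod 2])%N) :
  exists G : sgraph,
    [/\ vertex_connected 3 G, cubic G, planar R G,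
        at_least_strong_embeddings R G (torus R) 'C(2 * n, n - i) &
        at_least_strong_embeddings R G (klein_bottle R) 'C(2 * n, n - 1 + i)].
Proof.
set N1 := 'C(_, _); set N2 := 'C(_, _).
pose m := (2 * (N1 + N2) + 10)%N;
  have M0 : (0 < m.+3%:R :> R)%R by rewrite ltr0n.
have [p cp] := torus_cover M0; have [q cq] := klein_cover M0.
exists (prism m); split.
- exact: prism_3connected.
- exact: prism_cubic.
- exact: prism_planar.
- by apply: (@pattern_embeddings R m N1 false _ p); rewrite ?expr0 // /m; lia.
- by apply: (@pattern_embeddings R m N2 true _ q); rewrite ?expr1 // /m; lia.
Qed.
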